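(* Let $T>0$ and let $q\in L^2([0,T],\mathbb{C})$ be a periodic potential with associated monodromy $M(\lambda)$, and let $M_0(\lambda)$ be the vacuum monodromy. Then: (i) For every $\epsilon>0$ there exists $R>0$ such that for all $\lambda\in\mathbb{C}$ with $|\lambda|\ge R$ we have $|M(\lambda)-M_0(\lambda)|\le\epsilon\,|M_0(\lambda)|$. (ii) With $\lambda_{k,0}=\frac{2\pi}{T}k$ for $k\in\mathbb{Z}$, the sequence $\big(|M(\lambda_{k,0})-M_0(\lambda_{k,0})|\big)_{k\in\mathbb{Z}}$ lies in $\ell^2(\mathbb{Z})$. Both estimates hold uniformly if $q$ varies over a relatively compact subset of $L^2([0,T])$.
   Context: For $q\in L^2([0,T],\mathbb{C})$ (thought of as extended $T$-periodically to $\mathbb{R}$) let $F(t,\lambda)$, $\lambda\in\mathbb{C}$, solve $\frac{d}{dt}F=F\alpha$, $F(0,\lambda)=\mathbb{1}$, where $\alpha=\frac12\begin{pmatrix}\mathbf{i}\lambda&q\\-\bar q&-\mathbf{i}\lambda\end{pmatrix}$. The monodromy is $M(\lambda)=F(T,\lambda)\in\mathrm{SL}_2(\mathbb{C})$. The vacuum is the potential $q\equiv0$, with monodromy $M_0(\lambda)=\mathrm{diag}\big(e^{\mathbf{i}\lambda T/2},e^{-\mathbf{i}\lambda T/2}\big)$. $|\cdot|$ on $2\times2$ matrices is the maximum absolute row sum norm. Uniformity over a relatively compact set $Q\subset L^2([0,T])$ means: in (i), $R$ can be chosen independently of $q\in Q$; in (ii), the $\ell^2$-norms of the sequences are bounded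 by a constant independent of $q\in Q$. *)

(* Defs.v *)
From HB Require Import structures.
From mathcomp Require Import all_boot all_order all_algebra.
From mathcomp Require Import complex.
From mathcomp Require Import all_classical all_reals all_analysis.
From mathcomp Require Import measurable_realfun measurable_fun_approximation.

Set Implicit Arguments.
Unset Strict Implicit.
Unset Printing Implicit Defensive.

Import Order.TTheory GRing.Theory Num.Theory.
Import numFieldNormedType.Exports.

Local Open Scope classical_set_scope.
Local Open Scope ring_scope.
Local Open Scope complex_scope.

(* R-valued modulus: the norm `|z| of R[i] takes its values in R[i] *)
Notation normc := ComplexField.Normc.normc.
Notation Re := complex.Re.
Notation Im := complex.Im.

Section Complex.
Context {R : realType}.

Definition cexp (z : R[i]) : R[i] :=
  (expR (Re z) * cos (Im z)) +i* (expR (Re z) * sin (Im z)).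

Definition cintegral (D : set R) (f : R -> R[i]) : R[i] :=
  (\int[lebesgue_measure]_(t in D) Re (f t))%R
    +i* (\int[lebesgue_measure]_(t in D) Im (f t))%R.

End Complex.

(* Elements of L2 T are functions, not classes modulo equality a.e. on [0, T];
   their values outside [0, T] play no role. The topology below is the one of
   the L^2([0, T])-seminorm, so that L^2([0, T], C) is the Kolmogorov quotient
   of L2 T, and relative compactness has the same meaning in both. *)
Record L2 (R : realType) (T : R) := MkL2 {
  L2val :> R -> R[i] ;
  L2_measurable_Re : measurable_fun `[0, T] (fun t => Re (L2val t)) ;
  L2_measurable_Im : measurable_fun `[0, T] (fun t => Im (L2val t)) ;
  L2_finite : (\int[lebesgue_measure]_(t in `[0%R, T])
                 (normc (L2val t) ^+ 2)%:E < +oo)%E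
}.

Definition L2norm (R : realType) (T : R) (f : R -> R[i]) : R :=
  Num.sqrt (\int[lebesgue_measure]_(t in `[0, T]%classic) (normc (f t) ^+ 2))%R.

Definition L2ball (R : realType) (T : R) (p : L2 T) (e : R) (q : L2 T) : Prop :=
  L2norm T (fun t => p t - q t) < e.

Section L2_topology.
Context {R : realType} (T : R).
Local Notation mu := (@lebesgue_measure R).
Local Notation D := (`[0, T]%classic : set R).
Implicit Types (f g : R -> R[i]) (p q r : L2 T) (e : R).

Let cmeas f := measurable_fun D (fun t => Re (f t)) /\
  measurable_fun D (fun t => Im (f t)).

Let N f : \bar R := 'N[mu]_2%:E[EFin \o ((fun t => normc (f t)) \_ D)].

Let normcE (z : R[i]) : normc z = Num.sqrt (Re z ^+ 2 + Im z ^+ 2).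
Proof. by case: z. Qed.

Let normc_ge0 (z : R[i]) : 0 <= normc z.
Proof. by rewrite normcE sqrtr_ge0. Qed.

Let cmeasB f g : cmeas f -> cmeas g -> cmeas (fun t => f t - g t).
Proof.
move=> [f1 f2] [g1 g2]; split.
  rewrite (_ : (fun t => _) = (fun t => Re (f t)) \- (fun t => Re (g t))).
    exact: measurable_funB.
  by apply/funext => t /=; case: (f t) (g t) => [a b] [c d].
rewrite (_ : (fun t => _) = (fun t => Im (f t)) \- (fun t => Im (g t))).
  exact: measurable_funB.
by apply/funext => t /=; case: (f t) (g t) => [a b] [c d].
Qed.

Let cmeas_norm f : cmeas f -> measurable_fun D (fun t => normc (f t)).
Proof.
move=> [f1 f2].
rewrite (_ : (fun t => _) = fun t =>
    ((Re (f t) ^+ 2 + Im (f t) ^+ 2) `^ 2^-1)%R).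
  apply: (@measurableT_comp _ _ _ _ _ _ (@powR R ^~ 2^-1)) => //.
  apply: measurable_funD; exact: measurable_funX.
by apply/funext => t; rewrite normcE powR12_sqrt// addr_ge0 ?sqr_ge0.
Qed.

Let NE f : N f = ((\int[mu]_(t in D) (normc (f t) ^+ 2)%:E) `^ 2^-1)%E.
Proof.
rewrite /N unlock; congr (_ `^ _)%E.
rewrite [RHS]integral_mkcond; apply: eq_integral => t _ /=.
rewrite !patchE; case: ifPn => _ /=.
  by rewrite ger0_norm ?normc_ge0// powR_mulrn ?normc_ge0.
by rewrite normr0 powR0.
Qed.

Let N_ge0 f : (0 <= N f)%E. Proof. exact: Lnorm_ge0. Qed.

Let NL2norm f : (N f < +oo)%E -> (L2norm T f)%:E = N f.
Proof.
rewrite NE /L2norm /Rintegral.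
have : (0 <= \int[mu]_(t in D) (normc (f t) ^+ 2)%:E)%E.
  by apply: integral_ge0 => t _; rewrite lee_fin sqr_ge0.
case: (\int[mu]_(t in D) _)%E => [x| |]//=.
  by move=> x0 _; rewrite powR12_sqrt.
by rewrite invr_eq0 pnatr_eq0.
Qed.

Let N_lty p : (N p < +oo)%E.
Proof.
by rewrite NE; apply: poweR_lty; exact: L2_finite.
Qed.

Let cmeasL2 p : cmeas p.
Proof. by split; [exact: L2_measurable_Re|exact: L2_measurable_Im]. Qed.

Let measE f : cmeas f -> measurable_fun setT (EFin \o ((fun t => normc (f t)) \_ D)).
Proof.
move=> mf; apply/measurable_EFinP.
by apply/(measurable_restrictT _ _).1 => //; exact: cmeas_norm.
Qed.

Let N_sub f g h : cmeas f -> cmeas g ->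
  (forall t, normc (h t) <= normc (f t) + normc (g t)) -> cmeas h ->
  (N h <= N f + N g)%E.
Proof.
move=> mf mg hfg mh.
pose a : R -> R := (fun t => normc (f t)) \_ D.
pose b : R -> R := (fun t => normc (g t)) \_ D.
apply: (@le_trans _ _ ('N[mu]_2%:E[EFin \o (a \+ b)%R])%E); last first.
  apply: eminkowski; last by rewrite lee_fin ler1n.
    by apply/measurable_EFinP; exact: measE.
  by apply/measurable_EFinP; exact: measE.
rewrite /N unlock; apply: gt0_ler_poweR.
- by rewrite invr_ge0.
- by rewrite in_itv/= leey andbT integral_ge0// => t _; exact: poweR_ge0.
- by rewrite in_itv/= leey andbT integral_ge0// => t _; exact: poweR_ge0.
apply: ge0_le_integral => //.
- by move=> t _; exact: poweR_ge0.
- apply: (@measurableT_comp _ _ _ _ _ _ (fun x => x `^ 2)%E).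
    exact: measurable_poweR.
  by apply: measurableT_comp => //; exact: measE.
- apply: (@measurableT_comp _ _ _ _ _ _ (fun x => x `^ 2)%E).
    exact: measurable_poweR.
  apply: measurableT_comp => //; apply/measurable_EFinP.
  by apply: measurable_funD; apply/measurable_EFinP; exact: measE.
- move=> t _ /=; rewrite lee_fin /a /b !patchE.
  case: ifPn => _; last by rewrite addr0.
  have fg0 : 0 <= normc (f t) + normc (g t).
    by rewrite addr_ge0// normc_ge0.
  by rewrite ge0_ler_powR ?nnegrE// !ger0_norm// normc_ge0.
Qed.

Let normcN (z : R[i]) : normc (- z) = normc z.
Proof. by case: z => a b; rewrite !normcE/= !sqrrN. Qed.

Let normcB p q t : normc (p t - q t) = normc (q t - p t).
Proof. by rewrite -opprB normcN. Qed.

Let NB_lty p q : (N (fun t => (p t - q t)%R) < +oo)%E.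
Proof.
apply: (@le_lt_trans _ _ (N p + N q)%E); last by rewrite lte_add_pinfty.
apply: N_sub => //; last exact: cmeasB.
move=> t; rewrite (le_trans (le_normcD _ _))//.
by rewrite [X in _ + X <= _]normcN.
Qed.

Let ball_center p e : 0 < e -> L2ball p e p.
Proof.
rewrite /L2ball /L2norm => e0.
rewrite (_ : (\int[mu]_(t in D) _)%R = 0) ?sqrtr0//.
rewrite /Rintegral (_ : (\int[mu]_(t in D) _)%E = 0%E)//.
apply: integral0_eq => t _.
by rewrite subrr normcE/= expr0n addr0 sqrtr0 expr0n.
Qed.

Let ball_sym p q e : L2ball p e q -> L2ball q e p.
Proof.
rewrite /L2ball /L2norm; congr (Num.sqrt _ < _).
by apply: eq_Rintegral => t _; rewrite normcB.
Qed.

Let ball_triangle p q r e1 e2 :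
  L2ball p e1 q -> L2ball q e2 r -> L2ball p (e1 + e2) r.
Proof.
rewrite /L2ball => pq qr.
apply: le_lt_trans (ltrD pq qr); rewrite -lee_fin EFinD !NL2norm//.
apply: N_sub; [exact: cmeasB|exact: cmeasB| |exact: cmeasB] => t.
by rewrite -(subrKA (q t)) le_normcD.
Qed.

HB.instance Definition _ := gen_eqMixin (L2 T).
HB.instance Definition _ := gen_choiceMixin (L2 T).
HB.instance Definition _ := hasNbhs.Build (L2 T) (nbhs_ (entourage_ (@L2ball R T))).
HB.instance Definition _ := @Nbhs_isPseudoMetric.Build R (L2 T)
  (entourage_ (@L2ball R T)) erefl (@L2ball R T)
  ball_center ball_sym ball_triangle erefl.

End L2_topology.

Section ZakharovShabat.
Context {R : realType}.
Local Notation C := R[i].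

Definition mx2 (a b c d : C) : 'M[C]_2 :=
  \matrix_(i, j) (if i == 0 then if j == 0 then a else b
                  else if j == 0 then c else d).

Definition alpha (q : R -> C) (lam : C) (t : R) : 'M[C]_2 :=
  2^-1 *: mx2 ('i * lam) (q t) (- (q t)^*) (- ('i * lam)).

(* q being only square-integrable, dF/dt = F alpha with F(0) = 1 is understood
   in the sense of Caratheodory: F is continuous on [0, T] and satisfies
   F(t) = 1 + int_0^t F(s) alpha(s) ds for all t in [0, T]. *)
Definition fundamental_solution (T : R) (q : R -> C) (lam : C)
    (F : R -> 'M[C]_2) : Prop :=
  (forall i j, {within `[0, T], continuous (fun t => Re (F t i j))} /\
               {within `[0, T], continuous (fun t => Im (F t i j))}) /\
  (forall t, t \in `[0, T] -> forall i j,
     F t i j = (1%:M : 'M[C]_2) i j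
               + cintegral `[0, t] (fun s => (F s *m alpha q lam s) i j)).

Definition vacuum_monodromy (T : R) (lam : C) : 'M[C]_2 :=
  mx2 (cexp ('i * lam * (T / 2)%:C)) 0
      0 (cexp (- ('i * lam * (T / 2)%:C))).

Definition rowsum_norm (m n : nat) (A : 'M[C]_(m, n)) : R :=
  \big[Num.max/0]_(i < m) \sum_(j < n) normc (A i j).

Definition lambda0 (T : R) (k : int) : C := (2 * pi / T * k%:~R)%:C.

(* the l^2(Z)-norm, +oo if the sequence is not square-summable *)
Definition l2norm (a : int -> R) : \bar R :=
  sqrte (\esum_(k in [set: int]) (a k ^+ 2)%:E).

End ZakharovShabat.

(* Main.v *)
(* The entries (x, y) of a row of F solve x' = k x + y u, y' = - k y + x v with
   k = +-i lam / 2 and |u|, |v| <= |q|. By variation of constants, after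
   multiplication by the weight exp(- |Re k| t), the sizes z of x - exp(k t) and
   w of y satisfy
     z(t) <= int_0^t |q| w  and  w(t) <= g(t) + int_0^t |q| z,
   where g is the weighted modulus of the first-order term
   exp(- k t) int_0^t exp(2 k s) v(s) ds. Squaring, Cauchy-Schwarz and
   Gronwall's inequality bound the squared weighted deviation from the vacuum by
   C (g(T)^2 + int_0^T g^2), where C depends only on T and the L^2-norm of q.
   Then (i) is the Riemann-Lebesgue lemma sup_t g(t) -> 0 as |lam| -> oo, which
   is locally uniform in q. For (ii), lam = lambda0 T k turns 2 k into the
   frequencies of the Fourier basis, and Bessel's inequality, applied for each
   fixed t to v restricted to [0, t], bounds both sums over the frequencies.
   Squaring before summing avoids any maximal inequality. *)

Require Import Defs.
From mathcomp Require Import all_boot all_order all_algebra.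
From mathcomp Require Import complex.
From mathcomp Require Import all_classical all_reals all_analysis.
From mathcomp Require Import measurable_realfun measurable_fun_approximation.
From mathcomp Require Import ring lra.

Set Implicit Arguments.
Unset Strict Implicit.
Unset Printing Implicit Defensive.

Import Order.TTheory GRing.Theory Num.Theory.
Import numFieldNormedType.Exports.
Local Open Scope classical_set_scope.
Local Open Scope ring_scope.
Local Open Scope complex_scope.

(** * Integration by parts, Cauchy-Schwarz and Gronwall *)

Section RealIntegral.
Context {R : realType}.
Local Notation mu := (@lebesgue_measure R).
Implicit Types (f g h : R -> R) (a b t : R).

(** The weight exp(- |Re k| t) is the reciprocal of the row-sum norm of the vacuum solution at time
    t. A bound on the weighted deviation at T is therefore already the relative error asked for in
    (i), while on the real lattice [lambda0 T j] the weight is 1 and the same bound is absolute, as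
    (ii) requires. The weight also frees all constants from lam: it absorbs the kernels exp(+-k (t -
    s)) of variation of constants. The potential is only square-integrable and F only solves an
    integral equation, so no pointwise derivative of F is at hand; this is why variation of
    constants rests on Fubini over a triangle. Only w is forced by g, because the deviation of the
    diagonal entry is of second order in q. Eliminating z leaves one scalar inequality for w^2, to
    which Gronwall applies. For uniformity, (i) and a bound on the L^2-norm are proved on a ball
    around each potential, and compactness of the closure of Q then selects one threshold. *)

Lemma continuous_itv_integrable f a b :
  continuous f -> mu.-integrable `[a, b] (EFin \o f).
Proof.
move=> cf; apply: continuous_compact_integrable; first exact: segment_compact.
exact: continuous_subspaceT.
Qed.

Lemma integrable_mul_continuous h g a b :
  mu.-integrable `[a, b] (EFin \o h) -> {within `[a, b], continuous g} ->
  mu.-integrable `[a, b] (EFin \o (fun s => g s * h s)).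
Proof.
move=> ih cg.
apply: (@integrableMr _ _ _ mu `[a, b]%classic (measurable_itv _) g (EFin \o h)) => //.
- exact: subspace_continuous_measurable_fun.
- have /compact_bounded[M [_ mrt]] := continuous_compact cg (@segment_compact _ a b).
  by exists M; split; rewrite ?num_real // => ? ? ? ?; exact: mrt.
Qed.

Lemma Rintegral_derive f f' a b : a <= b ->
  (forall x : R, is_derive x 1 f (f' x)) -> continuous f' ->
  \int[mu]_(x in `[a, b]) f' x = f b - f a.
Proof.
rewrite le_eqVlt => /predU1P[<- _ _|ab df cf'].
  by rewrite set_itv1 Rintegral_set1 subrr.
rewrite /Rintegral (@continuous_FTC2 _ f' f)//.
- exact: continuous_subspaceT.
- have cf : continuous f.
    move=> x; apply: differentiable_continuous; apply/derivable1_diffP.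
    by case: (df x).
  split.
  + by move=> x _; case: (df x).
  + exact/cvg_at_right_filter/cf.
  + exact/cvg_at_left_filter/cf.
- by move=> x _; rewrite derive1E; case: (df x).
Qed.

(** Both sides are iterated integrals of [phi s * psi r] cut off by the indicator of [r <= s]. A
    product of integrable functions of separate variables is integrable on the square, so L^1
    suffices for both factors. *)
Lemma Rintegral_triangle (phi psi : R -> R) a b :
  mu.-integrable `[a, b] (EFin \o phi) -> mu.-integrable `[a, b] (EFin \o psi) ->
  \int[mu]_(s in `[a, b]) (phi s * \int[mu]_(r in `[a, s]) psi r) =
  \int[mu]_(r in `[a, b]) (psi r * \int[mu]_(s in `[r, b]) phi s).
Proof.
move=> iphi ipsi.
pose D : set R := `[a, b]%classic.
have mD : measurable (D : set (measurableTypeR R)) by exact: measurable_itv.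
(* Extension by zero turns the square into the whole plane, where Fubini is applied. *)
pose phiD : measurableTypeR R -> R := phi \_ D.
pose psiD : measurableTypeR R -> R := psi \_ D.
have iphiD : mu.-integrable setT (EFin \o phiD).
  by move/(integrable_mkcond (mu := mu) _ mD): iphi; rewrite restrict_EFin.
have ipsiD : mu.-integrable setT (EFin \o psiD).
  by move/(integrable_mkcond (mu := mu) _ mD): ipsi; rewrite restrict_EFin.
have mphi : measurable_fun setT phiD by apply/measurable_EFinP; exact: measurable_int iphiD.
have mpsi : measurable_fun setT psiD by apply/measurable_EFinP; exact: measurable_int ipsiD.
pose f (z : measurableTypeR R * measurableTypeR R) : \bar R :=
  (phiD z.1 * psiD z.2 * (z.2 <= z.1)%R%:R)%:E.
have mle : measurable_fun setT
    (fun z : measurableTypeR R * measurableTypeR R => (z.2 <= z.1)%R%:R : R).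
  rewrite (_ : (fun z => _) = \1_[set z : measurableTypeR R * measurableTypeR R |
      (z.2 <= z.1)%R]); last first.
    by apply/funext => z; rewrite indicE; congr (nat_of_bool _)%:R;
      apply/idP/idP; rewrite inE.
  apply: measurable_indic; rewrite -[X in measurable X]setTI.
  exact: measurable_fun_le.
have mphi1 : measurable_fun setT
    (fun z : measurableTypeR R * measurableTypeR R => phiD z.1).
  exact: measurableT_comp mphi measurable_fst.
have mpsi2 : measurable_fun setT
    (fun z : measurableTypeR R * measurableTypeR R => psiD z.2).
  exact: measurableT_comp mpsi measurable_snd.
have mphipsi : measurable_fun setT
    (fun z : measurableTypeR R * measurableTypeR R => (`|phiD z.1| * `|psiD z.2|)%:E).
  by apply/measurable_EFinP/measurable_funM; exact: measurableT_comp.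
have mf : measurable_fun setT f.
  apply/measurable_EFinP/measurable_funM => //; exact: measurable_funM.
(* Without the cut-off the absolute value is at most |phi| |psi|, whose iterated integral is the
   product of two finite L^1-norms. *)
have intf : (mu \x mu)%E.-integrable setT f.
  apply/integrable12ltyP => //.
  apply: (@le_lt_trans _ _ (\int[mu]_x \int[mu]_y (`|(phiD x)%:E| * `|(psiD y)%:E|))%E).
    apply: ge0_le_integral => //.
    - by move=> x _; apply: integral_ge0.
    - apply: (measurable_fun_fubini_tonelli_F (abse \o f)) => //=.
      exact: measurableT_comp.
    - apply: (measurable_fun_fubini_tonelli_F
        (fun z => `|(phiD z.1)%:E| * `|(psiD z.2)%:E|)%E) => //=.
    - move=> x _; apply: ge0_le_integral => //.
      + apply: measurableT_comp => //.
        exact: measurable_fun_pair2.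
      + apply: emeasurable_funM; apply: measurableT_comp => //; apply/measurable_EFinP => //.
      + move=> y _; rewrite /f /= -EFinM lee_fin !normrM -[leRHS]mulr1; apply: ler_wpM2l => //.
        by case: (y <= x); rewrite ?normr1 ?normr0.
  have maphi : measurable_fun setT (fun y => `|(phiD y)%:E|%E).
    by apply: measurableT_comp => //; exact/measurable_EFinP.
  have mapsi : measurable_fun setT (fun y => `|(psiD y)%:E|%E).
    by apply: measurableT_comp => //; exact/measurable_EFinP.
  rewrite (eq_integral (fun x => `|(phiD x)%:E| * \int[mu]_y `|(psiD y)%:E|)%E); last first.
    by move=> x _; rewrite ge0_integralZl.
  rewrite ge0_integralZr//; last exact: integral_ge0.
  move/integrableP : iphiD => [_ iphiD].
  move/integrableP : ipsiD => [_ ipsiD].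
  by apply: lte_mul_pinfty => //; [exact: integral_ge0|rewrite ge0_fin_numE// integral_ge0].
have subl s : D s -> `[a, s]%classic `<=` D.
  by rewrite /D/= in_itv/= => /andP[_ sb]; apply: subset_itvl; rewrite bnd_simp.
have subr s : D s -> `[s, b]%classic `<=` D.
  by rewrite /D/= in_itv/= => /andP[sa _]; apply: subset_itvr; rewrite bnd_simp.
have F1 s : (\int[mu]_r f (s, r) =
    ((fun s => phi s * \int[mu]_(r in `[a, s]) psi r) \_ D s)%:E)%E.
  rewrite patchE; case: ifPn => [|sD]; last first.
    by apply: integral0_eq => r _; rewrite /f/= /phiD patchE (negbTE sD) !mul0r.
  rewrite inE => sD.
  have ips : mu.-integrable `[a, s] (EFin \o psi).
    by apply: integrableS ipsi => //; exact: subl.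
  rewrite EFinM /Rintegral fineK; last exact: integrable_fin_num.
  rewrite -integralZl// [RHS]integral_mkcond; apply: eq_integral => r _.
  rewrite /f /phiD /psiD /= !patchE mem_set//.
  have [rs|rs] := boolP (r \in `[a, s]%classic).
    rewrite mem_set ?mulr1; last by apply: (subl s) => //; exact: set_mem.
    by move: rs; rewrite inE/= in_itv/= => /andP[_ ->]; rewrite mulr1.
  case: ifPn; last by rewrite mulr0 mul0r.
  rewrite inE /D/= in_itv/= => /andP[ar rb].
  by move: rs; rewrite notin_setE/= in_itv/= ar/= => /negP/negbTE ->; rewrite mulr0.
have F2 r : (\int[mu]_s f (s, r) =
    ((fun r => psi r * \int[mu]_(s in `[r, b]) phi s) \_ D r)%:E)%E.
  rewrite patchE; case: ifPn => [|rD]; last first.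
    by apply: integral0_eq => s _; rewrite /f/= /psiD patchE (negbTE rD) mulr0 mul0r.
  rewrite inE => rD.
  have ips : mu.-integrable `[r, b] (EFin \o phi).
    by apply: integrableS iphi => //; exact: subr.
  rewrite EFinM /Rintegral fineK; last exact: integrable_fin_num.
  rewrite -integralZl// [RHS]integral_mkcond; apply: eq_integral => s _.
  rewrite /f /phiD /psiD /= !patchE (mem_set rD).
  have [rs|rs] := boolP (s \in `[r, b]%classic).
    rewrite mem_set ?mulr1; last by apply: (subr r) => //; exact: set_mem.
    by move: rs; rewrite inE/= in_itv/= => /andP[-> _]; rewrite mulr1 mulrC.
  case: ifPn; last by rewrite !mul0r.
  rewrite inE /D/= in_itv/= => /andP[ar rb].
  by move: rs; rewrite notin_setE/= in_itv/= rb andbT => /negP/negbTE ->; rewrite mulr0.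
have := Fubini intf.
under eq_integral do rewrite F1.
under [RHS]eq_integral do rewrite F2.
by move=> /(congr1 fine) FE; rewrite Rintegral_mkcond [RHS]Rintegral_mkcond.
Qed.

(* The absolutely continuous factor is the primitive of [h], so that Fubini on
   the triangle [a <= r <= s <= b] replaces the product rule. *)
Lemma Rintegration_by_parts_ac (G G' h : R -> R) a b : a <= b ->
  (forall x : R, is_derive x 1 G (G' x)) -> continuous G' ->
  mu.-integrable `[a, b] (EFin \o h) ->
  \int[mu]_(s in `[a, b]) (G' s * \int[mu]_(r in `[a, s]) h r) =
  G b * \int[mu]_(s in `[a, b]) h s - \int[mu]_(s in `[a, b]) (G s * h s).
Proof.
move=> ab dG cG' ih.
have cG : continuous G.
  by move=> x; apply: differentiable_continuous; apply/derivable1_diffP; case: (dG x).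
have iGh : mu.-integrable `[a, b] (EFin \o (fun s => G s * h s)).
  by apply: integrable_mul_continuous => //; exact: continuous_subspaceT.
rewrite (@Rintegral_triangle G' h a b)//; last exact: continuous_itv_integrable.
rewrite -RintegralZl// -RintegralB//; last exact: (integrableZl _ (G b) ih).
apply: eq_Rintegral => r; rewrite inE/= in_itv/= => /andP[ar rb].
by rewrite (Rintegral_derive rb dG)//; ring.
Qed.

End RealIntegral.

Section CauchySchwarz.
Context d (T : measurableType d) (R : realType).
Variable mu : {measure set T -> \bar R}.
Implicit Types (f g : T -> R).

(** Discriminant argument: the integral of [(f x - c * g x) ^+ 2] is a quadratic polynomial in [c]
    that is never negative. *)
Lemma Rintegral_cauchy_schwarz (D : set T) f g : measurable D ->
  mu.-integrable D (EFin \o (fun x => f x ^+ 2)) ->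
  mu.-integrable D (EFin \o (fun x => g x ^+ 2)) ->
  mu.-integrable D (EFin \o (fun x => f x * g x)) ->
  (\int[mu]_(x in D) (f x * g x)) ^+ 2 <=
  (\int[mu]_(x in D) f x ^+ 2) * \int[mu]_(x in D) g x ^+ 2.
Proof.
move=> mD iff igg ifg.
set A := \int[mu]_(x in D) f x ^+ 2; set B := \int[mu]_(x in D) g x ^+ 2.
set I := \int[mu]_(x in D) _.
have key c : 0 <= A - 2 * c * I + c ^+ 2 * B.
  have i1 : mu.-integrable D (EFin \o (fun x => 2 * c * (f x * g x))).
    exact: (integrableZl mD (2 * c) ifg).
  have i2 : mu.-integrable D (EFin \o (fun x => c ^+ 2 * g x ^+ 2)).
    exact: (integrableZl mD (c ^+ 2) igg).
  have i3 : mu.-integrable D (EFin \o (fun x => f x ^+ 2 - 2 * c * (f x * g x))).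
    exact: (integrableB mD iff i1).
  rewrite -!RintegralZl// -RintegralB// -RintegralD//.
  apply: Rintegral_ge0 => x _.
  by rewrite [leRHS](_ : _ = (f x - c * g x) ^+ 2) ?sqr_ge0//; ring.
have B0 : 0 <= B by apply: Rintegral_ge0 => x _; exact: sqr_ge0.
have [B0'|Bn0] := eqVneq B 0.
  have [->|I0] := eqVneq I 0; first by rewrite B0' expr0n mulr0.
  (* For [B = 0] the polynomial is affine in [c]; this [c] gives it the value -1, which is
     absurd. *)
  have := key ((A + 1) / (2 * I)).
  rewrite B0' mulr0 addr0 (_ : 2 * _ * I = A + 1); last by field.
  lra.
have Bgt0 : 0 < B by rewrite lt_neqAle eq_sym Bn0.
(* The minimiser of the quadratic. *)
have := key (I / B).
rewrite (_ : A - _ + _ = (A * B - I ^+ 2) / B); last by field.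
by rewrite pmulr_lge0 ?invr_gt0// subr_ge0.
Qed.

End CauchySchwarz.

Section Gronwall.
Context {R : realType}.
Local Notation mu := (@lebesgue_measure R).
Implicit Types (f g h : R -> R) (a b c t : R).

Lemma is_derive_cmul c (x : R) : is_derive x 1 (fun s : R => c * s) c.
Proof.
by apply: is_derive_eq (is_deriveZ c (is_derive_id x 1)) _; rewrite /GRing.scale/= mulr1.
Qed.

Lemma Rintegral_itv_cst c a b : a <= b ->
  \int[mu]_(x in `[a, b]) c = c * (b - a).
Proof.
move=> ab; rewrite (Rintegral_derive ab (is_derive_cmul c)) -?mulrBr// => x.
exact: cvg_cst.
Qed.

Lemma is_derive_expRM c (x : R) :
  is_derive x 1 (fun s => expR (c * s)) (c * expR (c * x)).
Proof.
by apply: is_derive_eq (is_derive1_comp _ (is_derive_cmul c x)) _ ; rewrite mulrC.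
Qed.

Lemma is_derive_cosM c (x : R) :
  is_derive x 1 (fun s => cos (c * s)) (- c * sin (c * x)).
Proof.
by apply: is_derive_eq (is_derive1_comp _ (is_derive_cmul c x)) _ ; rewrite mulrC mulrN mulNr.
Qed.

Lemma is_derive_sinM c (x : R) :
  is_derive x 1 (fun s => sin (c * s)) (c * cos (c * x)).
Proof.
by apply: is_derive_eq (is_derive1_comp _ (is_derive_cmul c x)) _ ; rewrite mulrC.
Qed.

Lemma is_derive_continuous f f' :
  (forall x : R, is_derive x 1 f (f' x)) -> continuous f.
Proof.
move=> df x; apply: differentiable_continuous; apply/derivable1_diffP.
by case: (df x).
Qed.

Lemma integrable_mul_primitive g h a b : a <= b -> continuous g ->
  mu.-integrable `[a, b] (EFin \o h) ->
  mu.-integrable `[a, b] (EFin \o (fun s => g s * \int[mu]_(r in `[a, s]) h r)).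
Proof.
move=> ab cg ih.
apply: integrable_mul_continuous; last exact: continuous_subspaceT.
apply: continuous_compact_integrable; first exact: segment_compact.
exact: parameterized_integral_continuous.
Qed.

(** Let Phi be the primitive of [phi] and G(s) = exp(- K s). Then G (phi - K Phi) integrates to G(T)
    Phi(T) by parts, and it is at most G f <= f because f >= 0 and G <= 1 on [0, T]. The function
    [phi] need only be integrable, and the integral of [phi] is what the later estimate consumes. *)
Lemma gronwall (phi f : R -> R) (K T : R) : 0 <= T -> 0 <= K ->
  mu.-integrable `[0, T] (EFin \o phi) -> mu.-integrable `[0, T] (EFin \o f) ->
  (forall t, t \in `[0, T] -> 0 <= f t) ->
  (forall t, t \in `[0, T] -> phi t <= f t + K * \int[mu]_(s in `[0, t]) phi s) ->
  \int[mu]_(t in `[0, T]) phi t <= expR (K * T) * \int[mu]_(t in `[0, T]) f t.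
Proof.
move=> T0 K0 iphi if_ f0 phif.
pose G s := expR (- K * s).
have dG (x : R) : is_derive x 1 G (- K * G x) by exact: is_derive_expRM.
have cG : continuous G := is_derive_continuous dG.
have cG' : continuous (fun x => - K * G x).
  by move=> x; apply: cvgM; [exact: cvg_cst|exact: cG].
have iGphi : mu.-integrable `[0, T] (EFin \o (fun s => G s * phi s)).
  by apply: integrable_mul_continuous => //; exact: continuous_subspaceT.
have iGZ : mu.-integrable `[0, T]
    (EFin \o (fun s => - K * G s * \int[mu]_(r in `[0, s]) phi r)).
  exact: integrable_mul_primitive.
have /eqP := Rintegration_by_parts_ac T0 dG cG' iphi.
rewrite eq_sym subr_eq -RintegralD// => /eqP GZ.
have -> : expR (K * T) = (G T)^-1 by rewrite /G mulNr expRN invrK.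
rewrite mulrC ler_pdivlMr ?expR_gt0// mulrC GZ.
apply: le_Rintegral => //; first exact: (integrableD _ iGZ iGphi).
move=> t tT; rewrite [leLHS](_ : _ =
  G t * (phi t - K * \int[mu]_(r in `[0, t]) phi r)); last by ring.
have Gt1 : G t <= 1.
  rewrite -expR0 ler_expR mulNr oppr_le0 mulr_ge0//.
  by move: tT; rewrite /= in_itv/= => /andP[].
rewrite -[leRHS]mul1r; apply: (@le_trans _ _ (G t * f t)).
  by rewrite ler_wpM2l ?expR_ge0// lerBlDr phif.
by rewrite ler_wpM2r// f0.
Qed.

End Gronwall.

(** * Complex-valued integrals *)

Section ComplexIntegral.
Context {R : realType}.
Local Notation C := R[i].
Local Notation Re := complex.Re.
Local Notation Im := complex.Im.
Local Notation mu := (@lebesgue_measure R).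
Local Notation meas D := (measurable (D : set (measurableTypeR R))).
Implicit Types (f g h : R -> C) (z w c k : C) (D : set R) (a b t : R).

Definition cintegrable D f :=
  mu.-integrable D (EFin \o (fun t => Re (f t))) /\
  mu.-integrable D (EFin \o (fun t => Im (f t))).

Definition ccontinuous D f :=
  {within D, continuous (fun t => Re (f t))} /\
  {within D, continuous (fun t => Im (f t))}.

Lemma meas_itv a b : meas `[a, b].
Proof. exact: measurable_itv. Qed.

Lemma ReM z w : Re (z * w) = Re z * Re w - Im z * Im w.
Proof. by case: z w => [a b] [c d]. Qed.

Lemma ImM z w : Im (z * w) = Re z * Im w + Im z * Re w.
Proof. by case: z w => [a b] [c d]. Qed.

Lemma ReD z w : Re (z + w) = Re z + Re w.
Proof. by case: z w => [a b] [c d]. Qed.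

Lemma ImD z w : Im (z + w) = Im z + Im w.
Proof. by case: z w => [a b] [c d]. Qed.

Lemma ReN z : Re (- z) = - Re z. Proof. by case: z. Qed.

Lemma ImN z : Im (- z) = - Im z. Proof. by case: z. Qed.

Lemma complex_ext z w : Re z = Re w -> Im z = Im w -> z = w.
Proof. by case: z w => [a b] [c d] /= -> ->. Qed.

Lemma normcE z : normc z = Num.sqrt (Re z ^+ 2 + Im z ^+ 2).
Proof. by case: z. Qed.

Lemma normc_ge0 z : 0 <= normc z.
Proof. by rewrite normcE sqrtr_ge0. Qed.

Lemma sqr_normcE z : normc z ^+ 2 = Re z ^+ 2 + Im z ^+ 2.
Proof. by rewrite normcE sqr_sqrtr// addr_ge0 ?sqr_ge0. Qed.

Lemma normcM z w : normc (z * w) = normc z * normc w.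
Proof. exact: ComplexField.Normc.normcM. Qed.

Lemma normcN z : normc (- z) = normc z.
Proof. by rewrite !normcE ReN ImN !sqrrN. Qed.

Lemma normcJ z : normc (conjc z) = normc z.
Proof. by case: z => a b; rewrite !normcE/= sqrrN. Qed.

Lemma ler_Re_normc z : `|Re z| <= normc z.
Proof. by rewrite normcE -sqrtr_sqr ler_wsqrtr// lerDl sqr_ge0. Qed.

Lemma ler_Im_normc z : `|Im z| <= normc z.
Proof. by rewrite normcE -sqrtr_sqr ler_wsqrtr// lerDr sqr_ge0. Qed.

Lemma ler_normc_ReIm z : normc z <= `|Re z| + `|Im z|.
Proof.
rewrite -(@ler_pXn2r _ 2)// ?nnegrE ?normc_ge0 ?addr_ge0//.
rewrite sqr_normcE sqrrD !real_normK ?num_real// lerD2r lerDl.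
by rewrite mulrn_wge0// mulr_ge0.
Qed.

Lemma Re_cintegral D f : Re (cintegral D f) = \int[mu]_(t in D) Re (f t).
Proof. by []. Qed.

Lemma Im_cintegral D f : Im (cintegral D f) = \int[mu]_(t in D) Im (f t).
Proof. by []. Qed.

Lemma eq_cintegral D f g : {in D, f =1 g} -> cintegral D f = cintegral D g.
Proof.
by move=> fg; rewrite /cintegral; congr Complex;
  apply: eq_Rintegral => x xD; rewrite fg.
Qed.

Lemma cintegrableD D f g : meas D -> cintegrable D f -> cintegrable D g ->
  cintegrable D (fun t => f t + g t).
Proof.
move=> mD [f1 f2] [g1 g2]; split.
  by under eq_fun do rewrite ReD; exact: (integrableD mD f1 g1).
by under eq_fun do rewrite ImD; exact: (integrableD mD f2 g2).
Qed.

Lemma cintegralD D f g : meas D -> cintegrable D f -> cintegrable D g ->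
  cintegral D (fun t => f t + g t) = cintegral D f + cintegral D g.
Proof.
move=> mD [f1 f2] [g1 g2]; apply: complex_ext.
  by rewrite ReD /= -RintegralD//; apply: eq_Rintegral => x _; rewrite ReD.
by rewrite ImD /= -RintegralD//; apply: eq_Rintegral => x _; rewrite ImD.
Qed.

Lemma cintegrableZ D f k : meas D -> cintegrable D f ->
  cintegrable D (fun t => k * f t).
Proof.
move=> mD [f1 f2]; split.
  under eq_fun do rewrite ReM.
  exact: (integrableB mD (integrableZl mD (Re k) f1) (integrableZl mD (Im k) f2)).
under eq_fun do rewrite ImM.
exact: (integrableD mD (integrableZl mD (Re k) f2) (integrableZl mD (Im k) f1)).
Qed.

Lemma cintegralZ D f k : meas D -> cintegrable D f ->
  cintegral D (fun t => k * f t) = k * cintegral D f.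
Proof.
move=> mD [f1 f2].
have ZR (r : R) (f' : R -> R) : mu.-integrable D (EFin \o f') ->
  mu.-integrable D (EFin \o (fun t => r * f' t)) by exact: integrableZl.
apply: complex_ext.
  rewrite ReM /= -!RintegralZl// -RintegralB//; try exact: ZR.
  by apply: eq_Rintegral => x _; rewrite ReM.
rewrite ImM /= -!RintegralZl// -RintegralD//; try exact: ZR.
by apply: eq_Rintegral => x _; rewrite ImM.
Qed.

Lemma measurable_normc D f :
  measurable_fun D (fun t => Re (f t)) -> measurable_fun D (fun t => Im (f t)) ->
  measurable_fun (D : set (measurableTypeR R)) (fun t => normc (f t)).
Proof.
move=> f1 f2; rewrite (_ : (fun t => _) =
    fun t => ((Re (f t) ^+ 2 + Im (f t) ^+ 2) `^ 2^-1)%R).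
  apply: (@measurableT_comp _ _ _ _ _ _ (@powR R ^~ 2^-1)) => //.
  by apply: measurable_funD; exact: measurable_funX.
by apply/funext => t; rewrite normcE powR12_sqrt// addr_ge0 ?sqr_ge0.
Qed.

Lemma cintegrable_sum (I : Type) (r : seq I) D (f : I -> R -> C) :
  meas D -> (forall i, cintegrable D (f i)) ->
  cintegrable D (fun t => \sum_(i <- r) f i t).
Proof.
move=> mD fi; elim: r => [|i r IH].
  under [X in cintegrable _ X]eq_fun do rewrite big_nil.
  by split; exact: integrable0.
under [X in cintegrable _ X]eq_fun do rewrite big_cons.
exact: cintegrableD.
Qed.

Lemma cintegral_sum (I : Type) (r : seq I) D (f : I -> R -> C) :
  meas D -> (forall i, cintegrable D (f i)) ->
  cintegral D (fun t => \sum_(i <- r) f i t) = \sum_(i <- r) cintegral D (f i).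
Proof.
move=> mD fi; elim: r => [|i r IH].
  rewrite big_nil; under [X in cintegral _ X]eq_fun do rewrite big_nil.
  by apply: complex_ext; rewrite /= /Rintegral integral0.
under [X in cintegral _ X]eq_fun do rewrite big_cons.
by rewrite cintegralD// ?IH ?big_cons//; exact: cintegrable_sum.
Qed.

Lemma cintegrable_normc D f : meas D -> cintegrable D f ->
  mu.-integrable D (EFin \o (fun t => normc (f t))).
Proof.
move=> mD [f1 f2].
apply: (le_integrable mD _ _ (integrableD mD (integrable_norm f1) (integrable_norm f2))).
  apply/measurable_EFinP; apply: measurable_normc; apply/measurable_EFinP.
    exact: measurable_int f1.
  exact: measurable_int f2.
move=> x _ /=; rewrite lee_fin ger0_norm ?normc_ge0// ger0_norm ?addr_ge0//.
exact: ler_normc_ReIm.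
Qed.

Lemma le_cintegrable D f (h : R -> R) : meas D ->
  measurable_fun D (fun t => Re (f t)) -> measurable_fun D (fun t => Im (f t)) ->
  (forall t, D t -> normc (f t) <= h t) -> mu.-integrable D (EFin \o h) ->
  cintegrable D f.
Proof.
move=> mD m1 m2 fh ih; split; apply: (le_integrable mD _ _ ih).
- exact/measurable_EFinP.
- move=> x Dx /=; rewrite lee_fin (le_trans (ler_Re_normc _))//.
  by rewrite (le_trans (fh _ Dx))// ler_norm.
- exact/measurable_EFinP.
- move=> x Dx /=; rewrite lee_fin (le_trans (ler_Im_normc _))//.
  by rewrite (le_trans (fh _ Dx))// ler_norm.
Qed.

(** Rotation trick: with w the integral, |w|^2 is the real part of the integral of [conjc w * f t],
    and this integrand is at most |w| |f| in modulus. *)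
Lemma normc_cintegral_le D f : meas D -> cintegrable D f ->
  normc (cintegral D f) <= \int[mu]_(t in D) normc (f t).
Proof.
move=> mD cf; have nf := cintegrable_normc mD cf.
set w := cintegral D f.
have [->|w0] := eqVneq w 0.
  by rewrite ComplexField.Normc.normc0; apply: Rintegral_ge0 => x _; exact: normc_ge0.
have nw : 0 < normc w.
  rewrite lt_neqAle normc_ge0 andbT eq_sym.
  by apply: contra w0 => /eqP/ComplexField.Normc.eq0_normc ->.
rewrite -(ler_pM2l nw) -expr2 sqr_normcE.
have -> : Re w ^+ 2 + Im w ^+ 2 = Re (cintegral D (fun t => conjc w * f t)).
  rewrite cintegralZ// -/w; case: (w) => a b /=; ring.
rewrite -RintegralZl//; apply: le_Rintegral => //.
- by have [] := cintegrableZ (conjc w) mD cf.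
- exact: (integrableZl mD (normc w) nf).
- by move=> x _; rewrite -(normcJ w) -normcM (le_trans (ler_norm _)) ?ler_Re_normc.
Qed.

Lemma ccontinuousD D f g : ccontinuous D f -> ccontinuous D g ->
  ccontinuous D (fun t => f t + g t).
Proof.
move=> [f1 f2] [g1 g2]; split.
  by under eq_fun do rewrite ReD; move=> x; apply: cvgD; [exact: f1|exact: g1].
by under eq_fun do rewrite ImD; move=> x; apply: cvgD; [exact: f2|exact: g2].
Qed.

Lemma ccontinuousM D f g : ccontinuous D f -> ccontinuous D g ->
  ccontinuous D (fun t => f t * g t).
Proof.
move=> [f1 f2] [g1 g2]; split.
  under eq_fun do rewrite ReM; move=> x; apply: cvgB.
    by apply: cvgM; [exact: f1|exact: g1].
  by apply: cvgM; [exact: f2|exact: g2].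
under eq_fun do rewrite ImM; move=> x; apply: cvgD.
  by apply: cvgM; [exact: f1|exact: g2].
by apply: cvgM; [exact: f2|exact: g1].
Qed.

Lemma ccontinuous_cst D z : ccontinuous D (fun=> z).
Proof. by split=> x; exact: cvg_cst. Qed.

Lemma ccontinuous_normc D f : ccontinuous D f ->
  {within D, continuous (fun t => normc (f t))}.
Proof.
move=> [f1 f2]; under eq_fun do rewrite normcE.
move=> x; apply: (cvg_comp _ (@Num.sqrt R)); last exact: sqrt_continuous.
by apply: cvgD; apply: cvgM; [exact: f1|exact: f1|exact: f2|exact: f2].
Qed.

Lemma ccontinuous_cintegrable a b f : ccontinuous `[a, b] f ->
  cintegrable `[a, b] f.
Proof.
by move=> [f1 f2]; split; apply: continuous_compact_integrable => //;
  exact: segment_compact.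
Qed.

Lemma cintegrable_mul_continuous a b f h : cintegrable `[a, b] h ->
  ccontinuous `[a, b] f -> cintegrable `[a, b] (fun t => f t * h t).
Proof.
move=> [h1 h2] [f1 f2]; split.
  under [X in _ \o X]eq_fun do rewrite ReM.
  exact: (integrableB (meas_itv a b) (integrable_mul_continuous h1 f1)
    (integrable_mul_continuous h2 f2)).
under [X in _ \o X]eq_fun do rewrite ImM.
exact: (integrableD (meas_itv a b) (integrable_mul_continuous h2 f1)
  (integrable_mul_continuous h1 f2)).
Qed.

Lemma Re_cexpM c t : Re (cexp (c * t%:C)) = expR (Re c * t) * cos (Im c * t).
Proof. by rewrite /cexp/= ReM ImM/= !mulr0 subr0 add0r. Qed.

Lemma Im_cexpM c t : Im (cexp (c * t%:C)) = expR (Re c * t) * sin (Im c * t).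
Proof. by rewrite /cexp/= ReM ImM/= !mulr0 subr0 add0r. Qed.

Lemma ReMr z t : Re (z * t%:C) = Re z * t.
Proof. by rewrite ReM/= mulr0 subr0. Qed.

Lemma ImMr z t : Im (z * t%:C) = Im z * t.
Proof. by rewrite ImM/= mulr0 add0r. Qed.

Lemma ReMn2 z : Re (2 * z) = 2 * Re z.
Proof. by rewrite !mulr_natl !mulr2n ReD. Qed.

Lemma normc_cexp z : normc (cexp z) = expR (Re z).
Proof.
apply/eqP; rewrite -(@eqrXn2 _ 2)// ?normc_ge0 ?expR_ge0// sqr_normcE/=; apply/eqP.
by rewrite !exprMn -mulrDr cos2Dsin2 mulr1.
Qed.

Lemma cexpD z w : cexp (z + w) = cexp z * cexp w.
Proof.
by apply: complex_ext; rewrite ?ReM ?ImM /cexp/= ReD ImD expRD ?cosD ?sinD; ring.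
Qed.

Lemma cexp0 : cexp 0 = 1 :> C.
Proof. by apply: complex_ext; rewrite /cexp/= ?sin0 ?cos0 expR0 ?mulr1 ?mulr0. Qed.

Lemma cexpNM z : cexp (- z) * cexp z = 1.
Proof. by rewrite -cexpD addNr cexp0. Qed.

Lemma is_derive_Re_cexp c (x : R) :
  is_derive x 1 (fun s => Re (cexp (c * s%:C))) (Re (c * cexp (c * x%:C))).
Proof.
rewrite (_ : (fun s => _) =
  (fun s => expR (Re c * s)) * (fun s => cos (Im c * s))); last first.
  by apply/funext => s; rewrite Re_cexpM.
have d1 := is_derive_expRM (Re c) x; have d2 := is_derive_cosM (Im c) x.
apply: is_derive_eq (is_deriveM d1 d2) _.
by rewrite ReM Re_cexpM Im_cexpM /GRing.scale/=; ring.
Qed.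

Lemma is_derive_Im_cexp c (x : R) :
  is_derive x 1 (fun s => Im (cexp (c * s%:C))) (Im (c * cexp (c * x%:C))).
Proof.
rewrite (_ : (fun s => _) =
  (fun s => expR (Re c * s)) * (fun s => sin (Im c * s))); last first.
  by apply/funext => s; rewrite Im_cexpM.
have d1 := is_derive_expRM (Re c) x; have d2 := is_derive_sinM (Im c) x.
apply: is_derive_eq (is_deriveM d1 d2) _.
by rewrite ImM Re_cexpM Im_cexpM /GRing.scale/=; ring.
Qed.

Lemma continuous_Re_cexp c : continuous (fun s : R => Re (cexp (c * s%:C))).
Proof. exact: is_derive_continuous (is_derive_Re_cexp c). Qed.

Lemma continuous_Im_cexp c : continuous (fun s : R => Im (cexp (c * s%:C))).
Proof. exact: is_derive_continuous (is_derive_Im_cexp c). Qed.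

Lemma continuous_Re_Mcexp k c : continuous (fun s : R => Re (k * cexp (c * s%:C))).
Proof.
under eq_fun do rewrite ReM; move=> x; apply: cvgB; apply: cvgM.
- exact: cvg_cst.
- exact: continuous_Re_cexp.
- exact: cvg_cst.
- exact: continuous_Im_cexp.
Qed.

Lemma continuous_Im_Mcexp k c : continuous (fun s : R => Im (k * cexp (c * s%:C))).
Proof.
under eq_fun do rewrite ImM; move=> x; apply: cvgD; apply: cvgM.
- exact: cvg_cst.
- exact: continuous_Im_cexp.
- exact: cvg_cst.
- exact: continuous_Re_cexp.
Qed.

Lemma ccontinuous_cexp D c : ccontinuous D (fun s => cexp (c * s%:C)).
Proof.
split; apply: continuous_subspaceT.
  exact: continuous_Re_cexp.
exact: continuous_Im_cexp.
Qed.

Lemma ccontinuous_cexpB D c t : ccontinuous D (fun s => cexp (c * (t - s)%:C)).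
Proof.
rewrite (_ : (fun s => _) = (fun s => cexp (c * t%:C) * cexp (- c * s%:C))).
  by apply: ccontinuousM; [exact: ccontinuous_cst|exact: ccontinuous_cexp].
by apply/funext => s; rewrite rmorphB mulrBr cexpD mulNr.
Qed.

(** Keeping the factor [c] under the integral avoids a division, so that [c = 0] is covered. *)
Lemma cintegral_cexp c a b : a <= b ->
  cintegral `[a, b] (fun s => c * cexp (c * s%:C)) =
  cexp (c * b%:C) - cexp (c * a%:C).
Proof.
move=> ab; apply: complex_ext.
  rewrite ReD ReN -(Rintegral_derive ab (is_derive_Re_cexp c))//.
  exact: continuous_Re_Mcexp.
rewrite ImD ImN -(Rintegral_derive ab (is_derive_Im_cexp c))//.
exact: continuous_Im_Mcexp.
Qed.

(** Real and imaginary parts of the exponential and of [h] combine into four real integrations by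
    parts. *)
Lemma cintegration_by_parts c h a b : a <= b -> cintegrable `[a, b] h ->
  cintegral `[a, b] (fun s => c * cexp (c * s%:C) * cintegral `[a, s] h) =
  cexp (c * b%:C) * cintegral `[a, b] h -
  cintegral `[a, b] (fun s => cexp (c * s%:C) * h s).
Proof.
move=> ab [h1 h2].
have c1 := @continuous_Re_Mcexp c c; have c2 := @continuous_Im_Mcexp c c.
have [e1 e2] := ccontinuous_cexp `[a, b] c.
have i11 := integrable_mul_primitive ab c1 h1.
have i12 := integrable_mul_primitive ab c1 h2.
have i21 := integrable_mul_primitive ab c2 h1.
have i22 := integrable_mul_primitive ab c2 h2.
have j11 := integrable_mul_continuous h1 e1.
have j12 := integrable_mul_continuous h2 e1.
have j21 := integrable_mul_continuous h1 e2.
have j22 := integrable_mul_continuous h2 e2.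
have p11 := Rintegration_by_parts_ac ab (is_derive_Re_cexp c) c1 h1.
have p12 := Rintegration_by_parts_ac ab (is_derive_Re_cexp c) c1 h2.
have p21 := Rintegration_by_parts_ac ab (is_derive_Im_cexp c) c2 h1.
have p22 := Rintegration_by_parts_ac ab (is_derive_Im_cexp c) c2 h2.
apply: complex_ext.
  rewrite ReD ReN ReM !Re_cintegral Im_cintegral.
  under eq_Rintegral do rewrite ReM.
  rewrite RintegralB// p11 p22.
  under [X in _ = _ - X]eq_Rintegral do rewrite ReM.
  rewrite RintegralB//; ring.
rewrite ImD ImN ImM !Im_cintegral Re_cintegral.
under eq_Rintegral do rewrite ImM.
rewrite RintegralD// p12 p21.
under [X in _ = _ - X]eq_Rintegral do rewrite ImM.
rewrite RintegralD//; ring.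
Qed.

(** The integrating factor exp(- c s) is integrated by parts against the primitive of [c * f + h],
    which the equation itself identifies with [f - f0]. The two integrals of exp(- c s) f cancel,
    and [f] is never differentiated. *)
Lemma variation_of_constants c (f0 : C) f h t : 0 <= t ->
  cintegrable `[0, t] f -> cintegrable `[0, t] h ->
  (forall s, s \in `[0, t] ->
    f s = f0 + cintegral `[0, s] (fun r => c * f r + h r)) ->
  f t = cexp (c * t%:C) * f0 +
    cintegral `[0, t] (fun s => cexp (c * (t - s)%:C) * h s).
Proof.
move=> t0 if_ ih fE.
have mt := meas_itv 0 t.
pose G s := cexp (- c * s%:C).
have cG : ccontinuous `[0, t] G by exact: ccontinuous_cexp.
have icfh : cintegrable `[0, t] (fun r => c * f r + h r).
  by apply: cintegrableD => //; exact: cintegrableZ.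
have iG := ccontinuous_cintegrable cG.
have iGh := cintegrable_mul_continuous ih cG.
have iGcfh := cintegrable_mul_continuous icfh cG.
have iGf := cintegrable_mul_continuous if_ cG.
have := cintegration_by_parts (- c) t0 icfh.
have tt : t \in `[0, t] by rewrite in_itv/= t0 lexx.
have -> : cintegral `[0, t] (fun r => c * f r + h r) = f t - f0.
  by rewrite (fE t tt) addrC addKr.
have -> : cintegral `[0, t] (fun s => - c * cexp (- c * s%:C) *
    cintegral `[0, s] (fun r => c * f r + h r)) =
  cintegral `[0, t] (fun s => - c * (G s * f s) + f0 * (c * G s)).
  apply: eq_cintegral => s; rewrite inE/= => st.
  by rewrite (fE s st) /G; ring.
rewrite cintegralD//; [|exact: cintegrableZ|apply: cintegrableZ => //; exact: cintegrableZ].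
rewrite !cintegralZ//; last exact: cintegrableZ.
have -> : cintegral `[0, t] (fun s => cexp (- c * s%:C) * (c * f s + h s)) =
    c * cintegral `[0, t] (fun s => G s * f s) +
    cintegral `[0, t] (fun s => G s * h s).
  rewrite -cintegralZ// -cintegralD//; last exact: cintegrableZ.
  by apply: eq_cintegral => s _; rewrite /G; ring.
have cGE : c * cintegral `[0, t] G = 1 - G t.
  have := cintegral_cexp (- c) t0; rewrite -/(G t) mulr0 cexp0 cintegralZ//.
  by rewrite -/G => /eqP; rewrite mulNr eqr_oppLR opprB => /eqP.
have -> : cintegral `[0, t] (fun s => cexp (c * (t - s)%:C) * h s) =
    cexp (c * t%:C) * cintegral `[0, t] (fun s => G s * h s).
  rewrite -cintegralZ//; apply: eq_cintegral => s _.
  by rewrite rmorphB mulrBr cexpD /G mulNr mulrA.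
rewrite -mulrDr.
rewrite cGE -/(G t) => E.
(* What the integration by parts leaves after the cancellation; multiplying by exp(c t) then frees
   [f t]. *)
have -> : f0 + cintegral `[0, t] (fun s => G s * h s) = G t * f t.
  by apply/eqP; rewrite -subr_eq0; apply/eqP; move/eqP: E; rewrite -subr_eq0 => /eqP <-; ring.
by rewrite mulrA mulrC [X in _ * X]mulrC /G mulNr cexpNM mulr1.
Qed.

End ComplexIntegral.

(** * The first-order system *)

Section FirstOrderSystem.
Context {R : realType}.
Local Notation C := R[i].
Local Notation Re := complex.Re.
Local Notation Im := complex.Im.
Local Notation mu := (@lebesgue_measure R).
Implicit Types (u v x y f h : R -> C) (c k : C) (m : R -> R) (t T rho : R).

Lemma integrable_itvS (g : R -> R) t T : t \in `[0, T] ->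
  mu.-integrable `[0, T] (EFin \o g) -> mu.-integrable `[0, t] (EFin \o g).
Proof.
rewrite in_itv/= => /andP[_ tT]; apply: integrableS; [exact: measurable_itv..|].
by apply: subset_itvl; rewrite bnd_simp.
Qed.

Lemma cintegrable_itvS h t T : t \in `[0, T] ->
  cintegrable `[0, T] h -> cintegrable `[0, t] h.
Proof. by move=> tT [h1 h2]; split; exact: integrable_itvS tT _. Qed.

Lemma ccontinuous_itvS h t T : t \in `[0, T] ->
  ccontinuous `[0, T] h -> ccontinuous `[0, t] h.
Proof.
rewrite in_itv/= => /andP[_ tT].
have sub : `[0, t] `<=` `[0, T] by apply: subset_itvl; rewrite bnd_simp.
by move=> [h1 h2]; split; apply: continuous_subspaceW; eassumption.
Qed.

Lemma mem_itvS s t T : t \in `[0, T] -> s \in `[0, t] -> s \in `[0, T].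
Proof.
rewrite !in_itv/= => /andP[_ tT] /andP[-> st]; exact: le_trans st tT.
Qed.

Lemma le_Rintegral_itv (g : R -> R) t T : t \in `[0, T] ->
  mu.-integrable `[0, T] (EFin \o g) -> (forall s, s \in `[0, T] -> 0 <= g s) ->
  \int[mu]_(s in `[0, t]) g s <= \int[mu]_(s in `[0, T]) g s.
Proof.
move=> tT ig g0; rewrite -subr_ge0.
have := tT; rewrite in_itv/= => /andP[t0 tT'].
rewrite Rintegral_itvB ?bnd_simp//; apply: Rintegral_ge0 => s /=.
rewrite in_itv/= => /andP[ts sT]; apply: g0; rewrite in_itv/= sT andbT.
by rewrite (le_trans t0)// ltW.
Qed.

(** Since Re c <= rho and s <= t, |exp(c (t - s))| exp(- rho t) <= exp(- rho s): the weight moves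
    from the time of observation to the time of the source. *)
Lemma duhamel_le c h t rho : 0 <= t -> `|Re c| <= rho -> cintegrable `[0, t] h ->
  normc (cintegral `[0, t] (fun s => cexp (c * (t - s)%:C) * h s)) *
    expR (- rho * t) <=
  \int[mu]_(s in `[0, t]) (expR (- rho * s) * normc (h s)).
Proof.
move=> t0 crho ih; have mt := @meas_itv R 0 t.
have cE := ccontinuous_cexpB `[0, t] c t.
have iE := cintegrable_mul_continuous ih cE.
have ce : continuous (fun s => expR (- rho * s)).
  exact: is_derive_continuous (is_derive_expRM (- rho)).
apply: (@le_trans _ _ ((\int[mu]_(s in `[0, t])
    normc (cexp (c * (t - s)%:C) * h s)) * expR (- rho * t))).
  by rewrite ler_wpM2r ?expR_ge0//; exact: normc_cintegral_le.
have iEn := cintegrable_normc mt iE.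
rewrite -RintegralZr//; apply: le_Rintegral => //.
- exact: (integrableZr mt (expR (- rho * t)) iEn).
- apply: integrable_mul_continuous; first exact: cintegrable_normc.
  exact: continuous_subspaceT.
move=> s; rewrite /= in_itv/= => /andP[s0 st].
rewrite normcM normc_cexp mulrAC ler_wpM2r ?normc_ge0// -expRD ler_expR.
rewrite ReM/= mulr0 subr0.
have : Re c * (t - s) <= rho * (t - s).
  by rewrite ler_wpM2r ?subr_ge0// (le_trans (ler_norm _)).
lra.
Qed.

(* The first Picard iterate of the off-diagonal entry of the monodromy. *)
Definition fourier_term k v t : C :=
  cexp (- k * t%:C) * cintegral `[0, t] (fun s => cexp (2 * k * s%:C) * v s).

(** This is the solution of y' = - k y + exp(k t) v with y(0) = 0, the equation of the off-diagonal
    entry with the diagonal one set to its vacuum value. The form with frequency [2 * k] is the one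
    seen by Riemann-Lebesgue and Bessel. *)
Lemma fourier_termE k v t : cintegrable `[0, t] v -> fourier_term k v t =
  cintegral `[0, t] (fun s => cexp (- k * (t - s)%:C) * (cexp (k * s%:C) * v s)).
Proof.
move=> iv; rewrite /fourier_term -cintegralZ//; last first.
  by apply: cintegrable_mul_continuous => //; exact: ccontinuous_cexp.
apply: eq_cintegral => s _; rewrite !mulrA -!cexpD.
by congr (cexp _ * _); rewrite rmorphB; ring.
Qed.

Lemma ccontinuous_primitive h T : 0 <= T -> cintegrable `[0, T] h ->
  ccontinuous `[0, T] (fun t => cintegral `[0, t] h).
Proof.
by move=> T0 [h1 h2]; split; exact: parameterized_integral_continuous.
Qed.

Lemma ccontinuous_fourier_term k v T : 0 <= T -> cintegrable `[0, T] v ->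
  ccontinuous `[0, T] (fourier_term k v).
Proof.
move=> T0 iv; apply: ccontinuousM; first exact: ccontinuous_cexp.
apply: ccontinuous_primitive => //.
by apply: cintegrable_mul_continuous => //; exact: ccontinuous_cexp.
Qed.

End FirstOrderSystem.

(** * The weighted estimate for one row of the fundamental solution *)

Section SystemEstimate.
Context {R : realType}.
Local Notation C := R[i].
Local Notation Re := complex.Re.
Local Notation Im := complex.Im.
Local Notation mu := (@lebesgue_measure R).
Variables (T : R) (k : C) (u v x y : R -> C) (m : R -> R).
Hypothesis T0 : 0 <= T.
Hypothesis iu : cintegrable `[0, T] u.
Hypothesis iv : cintegrable `[0, T] v.
Hypothesis im : mu.-integrable `[0, T] (EFin \o m).
Hypothesis imm : mu.-integrable `[0, T] (EFin \o (fun t => m t ^+ 2)).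
Hypothesis um : forall t, t \in `[0, T] -> normc (u t) <= m t.
Hypothesis vm : forall t, t \in `[0, T] -> normc (v t) <= m t.
Hypothesis cx : ccontinuous `[0, T] x.
Hypothesis cy : ccontinuous `[0, T] y.
Hypothesis xE : forall t, t \in `[0, T] ->
  x t = 1 + cintegral `[0, t] (fun s => k * x s + y s * u s).
Hypothesis yE : forall t, t \in `[0, T] ->
  y t = cintegral `[0, t] (fun s => - k * y s + x s * v s).

Let rho := `|Re k|.
Let e t := expR (- rho * t).
Let w t := e t * normc (y t).
Let z t := e t * normc (x t - cexp (k * t%:C)).
Let g t := e t * normc (fourier_term k v t).
Let N := \int[mu]_(t in `[0, T]) m t ^+ 2.

Let ce : continuous e.
Proof. exact: is_derive_continuous (is_derive_expRM (- rho)). Qed.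

Let e0 t : 0 <= e t. Proof. exact: expR_ge0. Qed.

Let cw : {within `[0, T], continuous w}.
Proof.
move=> s; apply: cvgM; last exact: ccontinuous_normc.
exact: continuous_subspaceT.
Qed.

Let cg : {within `[0, T], continuous g}.
Proof.
move=> s; apply: cvgM; last exact: ccontinuous_normc (ccontinuous_fourier_term _ _ _) _.
exact: continuous_subspaceT.
Qed.

Let cX : ccontinuous `[0, T] (fun t => x t - cexp (k * t%:C)).
Proof.
rewrite (_ : (fun t => _) = (fun t => x t + (-1) * cexp (k * t%:C))); last first.
  by apply/funext => t; rewrite mulN1r.
apply: ccontinuousD => //; apply: ccontinuousM; first exact: ccontinuous_cst.
exact: ccontinuous_cexp.
Qed.

Let cz : {within `[0, T], continuous z}.
Proof.
move=> s; apply: cvgM; last exact: ccontinuous_normc.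
exact: continuous_subspaceT.
Qed.

Let m0 t : t \in `[0, T] -> 0 <= m t.
Proof. by move=> tT; exact: le_trans (normc_ge0 _) (um tT). Qed.

Let N0 : 0 <= N.
Proof. by apply: Rintegral_ge0 => t _; exact: sqr_ge0. Qed.

Let imw : mu.-integrable `[0, T] (EFin \o (fun t => w t * m t)).
Proof. exact: integrable_mul_continuous. Qed.

Let imz : mu.-integrable `[0, T] (EFin \o (fun t => z t * m t)).
Proof. exact: integrable_mul_continuous. Qed.

Let imT t : t \in `[0, T] -> 0 <= t.
Proof. by rewrite in_itv/= => /andP[]. Qed.

(** Variation of constants produces exp(k t) from the initial value 1, which cancels the vacuum part
    exactly; only the source [y s * u s] is left. *)
Let z_le t : t \in `[0, T] -> z t <= \int[mu]_(s in `[0, t]) (w s * m s).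
Proof.
move=> tT; have t0 := imT tT.
have iyu : cintegrable `[0, t] (fun s => y s * u s).
  apply: cintegrable_mul_continuous; first exact: cintegrable_itvS tT iu.
  exact: ccontinuous_itvS tT cy.
have ix : cintegrable `[0, t] x.
  by apply: ccontinuous_cintegrable; exact: ccontinuous_itvS tT cx.
have -> : z t = normc (cintegral `[0, t]
    (fun s => cexp (k * (t - s)%:C) * (y s * u s))) * e t.
  rewrite /z mulrC (variation_of_constants (c := k) (f0 := 1) t0 ix iyu).
    by rewrite mulr1 addrAC subrr add0r.
  by move=> s st; apply: xE; exact: mem_itvS tT st.
apply: (le_trans (duhamel_le t0 (lexx _) iyu)).
have mt := @meas_itv R 0 t.
apply: le_Rintegral => //.
- apply: integrable_mul_continuous; first exact: cintegrable_normc.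
  exact: continuous_subspaceT.
- exact: integrable_itvS tT imw.
move=> s st; rewrite normcM mulrA ler_wpM2l//.
  by rewrite mulr_ge0 ?expR_ge0 ?normc_ge0.
by apply: um; exact: mem_itvS tT st.
Qed.

(** Writing x as exp(k s) plus its deviation splits the source: the first part yields the Fourier
    term, the second is controlled by z. *)
Let w_le t : t \in `[0, T] -> w t <= g t + \int[mu]_(s in `[0, t]) (z s * m s).
Proof.
move=> tT; have t0 := imT tT; have mt := @meas_itv R 0 t.
have iv' := cintegrable_itvS tT iv.
have ixv : cintegrable `[0, t] (fun s => x s * v s).
  apply: cintegrable_mul_continuous => //.
  exact: ccontinuous_itvS tT cx.
have iev : cintegrable `[0, t] (fun s => cexp (k * s%:C) * v s).
  by apply: cintegrable_mul_continuous => //; exact: ccontinuous_cexp.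
have iXv : cintegrable `[0, t] (fun s => (x s - cexp (k * s%:C)) * v s).
  apply: cintegrable_mul_continuous => //; exact: ccontinuous_itvS tT cX.
have iy : cintegrable `[0, t] y.
  by apply: ccontinuous_cintegrable; exact: ccontinuous_itvS tT cy.
have cE := ccontinuous_cexpB `[0, t] (- k) t.
have -> : w t = normc (fourier_term k v t + cintegral `[0, t]
    (fun s => cexp (- k * (t - s)%:C) * ((x s - cexp (k * s%:C)) * v s))) * e t.
  rewrite /w mulrC (variation_of_constants (c := - k) (f0 := 0) t0 iy ixv).
    rewrite mulr0 add0r fourier_termE// -cintegralD//.
    - by congr (normc _ * _); apply: eq_cintegral => s _; ring.
    - exact: cintegrable_mul_continuous.
    - exact: cintegrable_mul_continuous.
  by move=> s st; rewrite add0r; apply: yE; exact: mem_itvS tT st.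
apply: (@le_trans _ _ (g t + normc (cintegral `[0, t]
    (fun s => cexp (- k * (t - s)%:C) * ((x s - cexp (k * s%:C)) * v s))) * e t)).
  rewrite /g [e t * _]mulrC -mulrDl ler_wpM2r//; exact: le_normcD.
rewrite lerD2l; apply: (le_trans (duhamel_le (rho := rho) t0 _ iXv)).
  by rewrite ReN normrN.
apply: le_Rintegral => //.
- apply: integrable_mul_continuous; first exact: cintegrable_normc.
  exact: continuous_subspaceT.
- exact: integrable_itvS tT imz.
move=> s st; rewrite normcM mulrA ler_wpM2l//.
  by rewrite mulr_ge0 ?expR_ge0 ?normc_ge0.
by apply: vm; exact: mem_itvS tT st.
Qed.

Let continuous_integrable (f : R -> R) :
  {within `[0, T], continuous f} -> mu.-integrable `[0, T] (EFin \o f).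
Proof. by move=> cf; apply: continuous_compact_integrable => //; exact: segment_compact. Qed.

Let continuous_sqr_integrable (f : R -> R) : {within `[0, T], continuous f} ->
  mu.-integrable `[0, T] (EFin \o (fun t => f t ^+ 2)).
Proof.
move=> cf; apply: continuous_integrable => s.
by apply: cvgM; exact: cf.
Qed.

Let iww : mu.-integrable `[0, T] (EFin \o (fun t => w t ^+ 2)).
Proof. exact: continuous_sqr_integrable. Qed.

Let igg : mu.-integrable `[0, T] (EFin \o (fun t => g t ^+ 2)).
Proof. exact: continuous_sqr_integrable. Qed.

Let w0 t : 0 <= w t. Proof. by rewrite mulr_ge0 ?normc_ge0. Qed.

Let J_le t : t \in `[0, T] -> (\int[mu]_(s in `[0, t]) (w s * m s)) ^+ 2 <=
  N * \int[mu]_(s in `[0, t]) w s ^+ 2.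
Proof.
move=> tT; have mt := @meas_itv R 0 t.
apply: (le_trans (@Rintegral_cauchy_schwarz _ _ _ mu _ w m mt (integrable_itvS tT iww)
  (integrable_itvS tT imm) (integrable_itvS tT imw))).
rewrite mulrC ler_wpM2r//.
  by apply: Rintegral_ge0 => s _; exact: sqr_ge0.
by apply: le_Rintegral_itv => // s _; exact: sqr_ge0.
Qed.

Let sqr_z_le t : t \in `[0, T] ->
  z t ^+ 2 <= N * \int[mu]_(s in `[0, t]) w s ^+ 2.
Proof.
move=> tT; apply: le_trans (J_le tT); rewrite lerXn2r ?nnegrE//.
- by rewrite mulr_ge0 ?normc_ge0.
- apply: Rintegral_ge0 => s st; rewrite mulr_ge0//.
  by apply: m0; exact: mem_itvS tT st.
- exact: z_le.
Qed.

(** Inserting the bound on z into that on w gives an inequality in w^2 alone, of Gronwall form with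
    constant [2 * T * N ^+ 2]. The factors 2 come from (g + I)^2 <= 2 g^2 + 2 I^2. *)
Let sqr_w_le t : t \in `[0, T] -> w t ^+ 2 <=
  2 * g t ^+ 2 + 2 * T * N ^+ 2 * \int[mu]_(s in `[0, t]) w s ^+ 2.
Proof.
move=> tT; have mt := @meas_itv R 0 t; have t0 := imT tT.
have tTT : t <= T by move: tT; rewrite in_itv/= => /andP[].
set W := \int[mu]_(s in `[0, t]) w s ^+ 2.
have W0 : 0 <= W by apply: Rintegral_ge0 => s _; exact: sqr_ge0.
set I := \int[mu]_(s in `[0, t]) (z s * m s).
have izz : mu.-integrable `[0, T] (EFin \o (fun t => z t ^+ 2)).
  exact: continuous_sqr_integrable.
(* Cauchy-Schwarz gives one factor [N]; the bound z(s)^2 <= N W for s <= t gives the other, and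
   integrating it over [0, t] the factor [T]. *)
have I2 : I ^+ 2 <= T * N ^+ 2 * W.
  apply: (le_trans (@Rintegral_cauchy_schwarz _ _ _ mu _ z m mt (integrable_itvS tT izz)
    (integrable_itvS tT imm) (integrable_itvS tT imz))).
  rewrite expr2 [leRHS](_ : _ = T * (N * W) * N); last by ring.
  apply: ler_pM.
  - by apply: Rintegral_ge0 => s _; exact: sqr_ge0.
  - by apply: Rintegral_ge0 => s _; exact: sqr_ge0.
  - apply: (@le_trans _ _ (\int[mu]_(s in `[0, t]) (N * W))).
      apply: le_Rintegral => //.
      + exact: integrable_itvS tT izz.
      + apply: (integrable_itvS tT); apply: continuous_integrable => s.
        exact: cvg_cst.
      move=> s st; have sT := mem_itvS tT st.
      apply: (le_trans (sqr_z_le sT)); rewrite ler_wpM2l//.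
      apply: le_Rintegral_itv => //; first exact: integrable_itvS tT iww.
      by move=> r _; exact: sqr_ge0.
    by rewrite Rintegral_itv_cst// subr0 mulrC ler_wpM2r// mulr_ge0.
  - by apply: le_Rintegral_itv => // s _; exact: sqr_ge0.
have I0 : 0 <= I.
  apply: Rintegral_ge0 => s st; rewrite mulr_ge0//.
    by rewrite mulr_ge0 ?normc_ge0.
  by apply: m0; exact: mem_itvS tT st.
have g0 : 0 <= g t by rewrite mulr_ge0 ?normc_ge0.
have : w t ^+ 2 <= (g t + I) ^+ 2.
  by rewrite lerXn2r ?nnegrE ?addr_ge0// w_le.
have := sqr_ge0 (g t - I); nra.
Qed.

(** Let W and G be the integrals of w^2 and g^2 over [0, T]. The pointwise bounds at T give z^2 +
    w^2 <= 2 g^2 + (N + 2 T N^2) W, and Gronwall with forcing 2 g^2 gives W <= 2 exp(2 T N^2 T)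
    G. *)
Lemma system_estimate :
  (expR (- `|Re k| * T) * normc (x T - cexp (k * T%:C))) ^+ 2 +
  (expR (- `|Re k| * T) * normc (y T)) ^+ 2 <=
  2 * (expR (- `|Re k| * T) * normc (fourier_term k v T)) ^+ 2 +
  2 * (N + 2 * T * N ^+ 2) * expR (2 * T * N ^+ 2 * T) *
    \int[mu]_(t in `[0, T])
      (expR (- `|Re k| * t) * normc (fourier_term k v t)) ^+ 2.
Proof.
have TT : T \in `[0, T] by rewrite in_itv/= T0 lexx.
have K0 : 0 <= 2 * T * N ^+ 2 by rewrite !mulr_ge0 ?sqr_ge0.
have := @gronwall R (fun t => w t ^+ 2) (fun t => 2 * g t ^+ 2) _ T T0 K0 iww.
move=> /(_ (integrableZl (meas_itv 0 T) 2 igg)).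
move=> /(_ (fun t _ => mulr_ge0 (ler0n _ 2) (sqr_ge0 _)) sqr_w_le).
rewrite RintegralZl//.
have := sqr_w_le TT; have := sqr_z_le TT.
rewrite -/rho -/(e T) -/(w T) -/(g T) -/(z T).
rewrite (_ : \int[mu]_(t in `[0, T]) (_ * _) ^+ 2 =
  \int[mu]_(t in `[0, T]) g t ^+ 2)//.
set W := \int[mu]_(s in `[0, T]) w s ^+ 2.
set G := \int[mu]_(s in `[0, T]) g s ^+ 2.
move: (expR _) => E hz hw hW.
have h : (N + 2 * T * N ^+ 2) * W <= (N + 2 * T * N ^+ 2) * (E * (2 * G)).
  by rewrite ler_wpM2l// addr_ge0.
move: hz hw h; move: (2 * T * N ^+ 2) => K; nra.
Qed.

End SystemEstimate.

(** * The Riemann-Lebesgue lemma *)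

Section RiemannLebesgue.
Context {R : realType}.
Local Notation C := R[i].
Local Notation Re := complex.Re.
Local Notation Im := complex.Im.
Local Notation mu := (@lebesgue_measure R).
Implicit Types (v p h : R -> C) (k : C) (a t T : R).

Lemma Rintegral_itv_split (f : R -> R) a t : 0 <= a -> a <= t ->
  mu.-integrable `[0, t] (EFin \o f) ->
  \int[mu]_(s in `[0, t]) f s =
  \int[mu]_(s in `[0, a]) f s + \int[mu]_(s in `[a, t]) f s.
Proof.
move=> a0 at_ if_.
rewrite -(@Rintegral_itv_obnd_cbnd _ a); last first.
  by apply: integrableS if_ => //; apply: subset_itvr; rewrite bnd_simp.
by rewrite -(Rintegral_itvB if_) ?bnd_simp// addrC subrK.
Qed.

Lemma cintegral_itv_split h a t : 0 <= a -> a <= t -> cintegrable `[0, t] h ->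
  cintegral `[0, t] h = cintegral `[0, a] h + cintegral `[a, t] h.
Proof.
move=> a0 at_ [h1 h2]; apply: complex_ext.
  by rewrite ReD !Re_cintegral; exact: Rintegral_itv_split.
by rewrite ImD !Im_cintegral; exact: Rintegral_itv_split.
Qed.

(** The two exponentials have joint modulus exp(Re k (2 s - t)), and |2 s - t| <= t for 0 <= s <= t.
    This keeps non-real lam under control. *)
Lemma cexp_weight_le1 k s t : 0 <= s -> s <= t ->
  expR (- `|Re k| * t) * normc (cexp (- k * t%:C)) *
    normc (cexp (2 * k * s%:C)) <= 1.
Proof.
move=> s0 st; rewrite !normc_cexp -!expRD -expR0 ler_expR !ReMr ReMn2 ReN.
have : Re k * (2 * s - t) <= `|Re k| * t.
  rewrite (le_trans (ler_norm _))// normrM ler_wpM2l// ler_norml.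
  by apply/andP; split; lra.
lra.
Qed.

Lemma weighted_cexp_le k h a t : 0 <= a -> a <= t -> cintegrable `[a, t] h ->
  expR (- `|Re k| * t) * normc (cexp (- k * t%:C) *
    cintegral `[a, t] (fun s => cexp (2 * k * s%:C) * h s)) <=
  \int[mu]_(s in `[a, t]) normc (h s).
Proof.
move=> a0 at_ ih; have mt := @meas_itv R a t.
have iE : cintegrable `[a, t] (fun s => cexp (2 * k * s%:C) * h s).
  by apply: cintegrable_mul_continuous => //; exact: ccontinuous_cexp.
have iEn := cintegrable_normc mt iE.
rewrite normcM mulrA.
set W := expR _ * normc _; have W0 : 0 <= W by rewrite mulr_ge0 ?expR_ge0 ?normc_ge0.
apply: (@le_trans _ _ (W * \int[mu]_(s in `[a, t]) normc (cexp (2 * k * s%:C) * h s))).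
  by rewrite ler_wpM2l//; exact: normc_cintegral_le.
rewrite -RintegralZl//; apply: le_Rintegral => //.
- exact: (integrableZl mt W iEn).
- exact: cintegrable_normc.
move=> s; rewrite /= in_itv/= => /andP[as_ st].
rewrite normcM mulrA -[leRHS]mul1r ler_wpM2r ?normc_ge0//.
by apply: cexp_weight_le1 => //; exact: le_trans as_.
Qed.

(** By linearity in [v], this is a Lipschitz bound in L^1, uniform in [k] and [t]; it transfers
    decay from continuous functions to integrable ones. *)
Lemma normc_fourier_term_le k v t T : t \in `[0, T] -> cintegrable `[0, T] v ->
  expR (- `|Re k| * t) * normc (fourier_term k v t) <=
  \int[mu]_(s in `[0, T]) normc (v s).
Proof.
move=> tT iv; have := tT; rewrite in_itv/= => /andP[t0 _].
apply: le_trans (weighted_cexp_le _ (lexx 0) t0 (cintegrable_itvS tT iv)) _.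
apply: le_Rintegral_itv => //; first exact: cintegrable_normc.
by move=> s _; exact: normc_ge0.
Qed.

Lemma fourier_termD k v h t : cintegrable `[0, t] v -> cintegrable `[0, t] h ->
  fourier_term k (fun s => v s + h s) t = fourier_term k v t + fourier_term k h t.
Proof.
move=> iv ih; rewrite /fourier_term -mulrDr -cintegralD//.
- by congr (_ * _); apply: eq_cintegral => s _; rewrite mulrDr.
- by apply: cintegrable_mul_continuous => //; exact: ccontinuous_cexp.
- by apply: cintegrable_mul_continuous => //; exact: ccontinuous_cexp.
Qed.

(** Heine-Cantor in the form of a near covering: the modulus [d] is the parameter, tending to 0 from
    the right. Only [s] is confined to the compact interval. *)
Lemma continuous_itv_unif (f : R -> R) a b (eps : R) : continuous f -> 0 < eps ->
  exists2 d, 0 < d & forall s t, s \in `[a, b] -> `|s - t| <= d ->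
    `|f s - f t| <= eps.
Proof.
move=> cf e0.
have nc := (compact_near_coveringP _).1 (@segment_compact R a b).
have H : \forall d \near 0^'+, `[a, b]%classic `<=`
    (fun s => forall t, `|s - t| <= d -> `|f s - f t| <= eps).
  apply: nc => x _; have /cvgrPdist_lt/(_ (eps / 2)) := cf x.
  rewrite divr_gt0// => /(_ isT)[d/= d0 xd].
  (* Halving [d] keeps both [y] and every [t] within [e] of [y] at distance less than [d] from
     [x]. *)
  exists (ball x (d / 2), [set e | e < d / 2]) => /=.
    split; first by apply: nbhsx_ballx; rewrite divr_gt0.
    by apply: nbhs_right_lt; rewrite divr_gt0.
  move=> [y e]/= [xy ed] t yt.
  have h1 : `|f x - f y| < eps / 2.
    by apply: xd; rewrite /ball/= in xy *; lra.
  have h2 : `|f x - f t| < eps / 2.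
    apply: xd; rewrite /= -(subrKA y) (le_lt_trans (ler_normD _ _))//.
    by rewrite /ball/= in xy; lra.
  rewrite -(subrKA (f x)) (le_trans (ler_normD _ _))// distrC; lra.
near (0 : R)^'+ => d; exists d => // s t sab.
have : `[a, b]%classic `<=`
    (fun s => forall t, `|s - t| <= d -> `|f s - f t| <= eps).
  by near: d.
by move=> /(_ s); apply.
Unshelve. all: by end_near. Qed.

(** The order of choices matters: the mesh, hence the number [n] of pieces, depends only on [p], [T]
    and [eps], so the [n] endpoint contributions of size O(1 / |k|) vanish as |k| grows. *)
Lemma riemann_lebesgue_continuous p T : 0 < T ->
  continuous (fun t => Re (p t)) -> continuous (fun t => Im (p t)) ->
  forall eps : R, 0 < eps -> exists2 r : R, 0 < r &
    forall k, r <= normc k -> forall t, t \in `[0, T] ->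
      expR (- `|Re k| * t) * normc (fourier_term k p t) <= eps.
Proof.
move=> T0 c1 c2 eps eps0.
(* The errors from freezing [p] add up to [e * t], at most [eps / 2]. *)
pose e := eps / (2 * T).
have e0 : 0 < e by rewrite divr_gt0// mulr_gt0.
have [d d0 dP] : exists2 d, 0 < d & forall s t, s \in `[0, T] -> `|s - t| <= d ->
    normc (p s - p t) <= e.
  have e20 : 0 < e / 2 by rewrite divr_gt0.
  have [d1 d10 d1P] := continuous_itv_unif 0 T c1 e20.
  have [d2 d20 d2P] := continuous_itv_unif 0 T c2 e20.
  exists (Num.min d1 d2); first by rewrite lt_min d10.
  move=> s t sT; rewrite le_min => /andP[st1 st2].
  rewrite (le_trans (ler_normc_ReIm _))// (splitr e) ReD ImD ReN ImN.
  by rewrite lerD// ?d1P ?d2P.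
have cp : ccontinuous `[0, T] p by split; exact: continuous_subspaceT.
have ip := ccontinuous_cintegrable cp.
have [M M0 MP] : exists2 M, 0 < M & forall s, s \in `[0, T] -> normc (p s) <= M.
  have /compact_bounded[M [_ mrt]] :=
    continuous_compact (ccontinuous_normc cp) (@segment_compact _ 0 T).
  exists (`|M| + 1); first by rewrite ltr_wpDl.
  move=> s sT; rewrite (le_trans (ler_norm _))//; apply: mrt; last by exists s.
  by rewrite ltr_pwDr// ler_norm.
(* Induction over a partition of mesh [d]: on each piece [p] is within [e] of
   a constant, against which the exponential integrates to [O(1 / normc k)]. *)
have step k (n : nat) : k != 0 -> forall t, t \in `[0, T] -> t <= n%:R * d ->
    expR (- `|Re k| * t) * normc (fourier_term k p t) <=
    e * t + n%:R * (M / normc k).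
  move=> k0; have nk : 0 < normc k.
    rewrite lt_neqAle normc_ge0 andbT eq_sym.
    by apply: contra k0 => /eqP/ComplexField.Normc.eq0_normc ->.
  elim: n => [|n IH] t tT tn.
    have t0 : t = 0.
      apply/eqP; rewrite eq_le -[X in _ <= X](mul0r d) tn.
      by move: tT; rewrite in_itv/= => /andP[].
    rewrite t0 !mulr0 mul0r addr0 /fourier_term [cintegral _ _](_ : _ = 0).
      by rewrite mulr0 ComplexField.Normc.normc0 mulr0.
    by apply: complex_ext; rewrite /= set_itv1 Rintegral_set1.
  have [t0 tT'] : 0 <= t /\ t <= T by move: tT; rewrite in_itv/= => /andP[].
  have [tn'|nt] := leP t (n%:R * d).
    apply: (le_trans (IH _ tT tn')); rewrite lerD2l ler_wpM2r ?ler_nat//.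
    by rewrite ltW// divr_gt0.
  set a := n%:R * d in nt *.
  have a0 : 0 <= a by rewrite mulr_ge0// ltW.
  have aT : a \in `[0, T] by rewrite in_itv/= a0 (le_trans (ltW nt)).
  have ta : t - a <= d by move: tn; rewrite -natr1 mulrDl mul1r -/a; lra.
  have {}IH := IH _ aT (lexx _).
  have mt := @meas_itv R a t.
  have ipt := cintegrable_itvS tT ip.
  have cat f : ccontinuous `[0, T] f -> ccontinuous `[a, t] f.
    move=> [f1 f2]; have sub : `[a, t] `<=` `[0, T].
      by apply: subset_itv; rewrite bnd_simp.
    by split; apply: continuous_subspaceW; eassumption.
  have ipa : cintegrable `[a, t] (fun s => p s - p a).
    apply: ccontinuous_cintegrable; apply: ccontinuousD; first exact: cat.
    exact: ccontinuous_cst.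
  have iE : cintegrable `[0, t] (fun s => cexp (2 * k * s%:C) * p s).
    by apply: cintegrable_mul_continuous => //; exact: ccontinuous_cexp.
  have iEa : cintegrable `[a, t] (fun s => cexp (2 * k * s%:C) * (p s - p a)).
    by apply: cintegrable_mul_continuous => //; exact: ccontinuous_cexp.
  have iex : cintegrable `[a, t] (fun s => cexp (2 * k * s%:C)).
    by apply: ccontinuous_cintegrable; exact: ccontinuous_cexp.
  have k20 : 2 * k != 0 by rewrite mulf_neq0.
  (* The three terms are the part up to [a], propagated from [a] to [t]; the oscillation of [p]
     around [p a]; and the constant [p a], integrated exactly. *)
  have -> : fourier_term k p t =
      cexp (- k * (t - a)%:C) * fourier_term k p a +
      cexp (- k * t%:C) * cintegral `[a, t] (fun s => cexp (2 * k * s%:C) * (p s - p a)) +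
      p a * (cexp (- k * t%:C) * ((cexp (2 * k * t%:C) - cexp (2 * k * a%:C)) / (2 * k))).
    rewrite -cintegral_cexp ?ltW// cintegralZ// [_ * cintegral _ _ / _]mulrC mulKf//.
    rewrite {1}/fourier_term (cintegral_itv_split a0 (ltW nt))//.
    rewrite [X in _ * (_ + X)](_ : _ =
      cintegral `[a, t] (fun s => cexp (2 * k * s%:C) * (p s - p a)) +
      p a * cintegral `[a, t] (fun s => cexp (2 * k * s%:C))); last first.
      rewrite -cintegralZ// -cintegralD//; last exact: cintegrableZ.
      by apply: eq_cintegral => s _; ring.
    rewrite /fourier_term mulrA -cexpD.
    rewrite (_ : - k * (t - a)%:C + - k * a%:C = - k * t%:C); last first.
      by rewrite rmorphB; ring.
    ring.
  set A1 := _ * fourier_term _ _ _; set A2 := _ * cintegral _ _; set A3 := _ * (_ * _).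
  have h1 : expR (- `|Re k| * t) * normc A1 <= e * a + n%:R * (M / normc k).
    apply: le_trans IH; rewrite /A1 normcM mulrA ler_wpM2r ?normc_ge0//.
    rewrite normc_cexp -expRD ler_expR ReM ReN/= mulr0 subr0.
    have : - Re k * (t - a) <= `|Re k| * (t - a).
      by rewrite ler_wpM2r ?subr_ge0 ?(ltW nt)// -normrN ler_norm.
    lra.
  have h2 : expR (- `|Re k| * t) * normc A2 <= e * (t - a).
    apply: le_trans (weighted_cexp_le _ a0 (ltW nt) ipa) _.
    apply: (@le_trans _ _ (\int[mu]_(s in `[a, t]) e)); last first.
      by rewrite Rintegral_itv_cst// ltW.
    apply: le_Rintegral => //.
    - exact: cintegrable_normc.
    - by apply: continuous_itv_integrable => x; exact: cvg_cst.
    move=> s; rewrite /= in_itv/= => /andP[as_ st].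
    have sT : s \in `[0, T] by rewrite in_itv/= (le_trans a0 as_) (le_trans st).
    by apply: dP => //; rewrite ger0_norm ?subr_ge0//; lra.
  have h3 : expR (- `|Re k| * t) * normc A3 <= M / normc k.
    rewrite /A3 !normcM ComplexField.Normc.normcV [normc (2 * k)]normcM.
    have n2 : normc (2 : C) = 2.
      by rewrite normcE/= [X in Num.sqrt X](_ : _ = 2 ^+ 2) ?sqrtr_sqr ?ger0_norm//; ring.
    rewrite n2; set L := expR _; set P := normc (cexp _); set D := normc (_ - _).
    (* Each of the two endpoint exponentials has weighted modulus at most 1; the 2 cancels against
       the denominator [2 * k]. *)
    have LPD : L * P * D <= 2.
      apply: (@le_trans _ _ (L * P *
          (normc (cexp (2 * k * t%:C)) + normc (cexp (2 * k * a%:C))))).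
        rewrite ler_wpM2l ?mulr_ge0 ?expR_ge0 ?normc_ge0//.
        by rewrite (le_trans (le_normcD _ _))// normcN.
      rewrite mulrDr -[leRHS]/(1 + 1) lerD//; apply: cexp_weight_le1 => //; exact: ltW.
    rewrite [leLHS](_ : _ = normc (p a) * (L * P * D) / (2 * normc k)); last by ring.
    rewrite ler_pdivrMr ?mulr_gt0// [leRHS](_ : _ = M * 2); last first.
      by field; rewrite gt_eqF.
    by apply: ler_pM; rewrite ?normc_ge0 ?mulr_ge0 ?expR_ge0 ?normc_ge0 ?MP.
  have h12 : normc (A1 + A2 + A3) <= normc A1 + normc A2 + normc A3.
    by rewrite (le_trans (le_normcD _ _))// lerD2r le_normcD.
  have := ler_wpM2l (expR_ge0 (- `|Re k| * t)) h12.
  rewrite -natr1 !mulrDr mulrDl mul1r; lra.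
pose n := Num.bound (T / d).
have Tn : T <= n%:R * d.
  by rewrite -ler_pdivrMr// ltW// archi_boundP// divr_ge0 ?ltW.
(* Beyond this threshold [n%:R * (M / normc k)] is at most [eps / 2]; the added 1 makes the
   threshold positive. *)
exists (n%:R * M / (eps / 2) + 1).
  by rewrite ltr_wpDl// divr_ge0 ?mulr_ge0 ?divr_ge0 ?ltW.
move=> k rk t tT.
have nk : 0 < normc k.
  by apply: lt_le_trans rk; rewrite ltr_wpDl// divr_ge0 ?mulr_ge0 ?divr_ge0 ?ltW.
have k0 : k != 0.
  by apply: contraTneq nk => ->; rewrite ComplexField.Normc.normc0 ltxx.
have tTT : t <= T by move: tT; rewrite in_itv/= => /andP[].
apply: (le_trans (step k n k0 t tT (le_trans tTT Tn))).
rewrite (splitr eps) lerD//.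
  rewrite /e [leRHS](_ : _ = eps / (2 * T) * T); last by field; rewrite gt_eqF.
  by rewrite ler_wpM2l// ltW.
rewrite mulrA ler_pdivrMr// [leRHS]mulrC -ler_pdivrMr ?divr_gt0//.
by apply: le_trans rk; rewrite lerDl.
Qed.

Lemma continuous_L1_approx (f : R -> R) T (eps : R) : 0 < eps ->
  mu.-integrable `[0, T] (EFin \o f) ->
  exists2 g : R -> R, continuous g & \int[mu]_(t in `[0, T]) `|f t - g t| <= eps.
Proof.
move=> e0 if_; have mT := @meas_itv R 0 T.
have fin : (lebesgue_measure (`[0%R, T]%classic : set R) < +oo)%E.
  exact: compact_finite_measure (@segment_compact _ _ _).
have [g_ [cg ig gf]] := approximation_continuous_integrable mT fin if_.
have /fine_cvgP[_ /cvgrPdist_lt/(_ _ e0)[n _ /(_ n (leqnn n))]] := gf.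
rewrite /= sub0r normrN => h; exists (g_ n) => //.
by apply: ltW; apply: le_lt_trans h; rewrite ler_norm.
Qed.

(** One continuous approximant [p] of [v] serves the whole L^1-ball: every [h] in it is within
    [2 * eps] of [p], and the Fourier term of [p] contributes the third [eps]. *)
Lemma riemann_lebesgue v T (eps : R) : 0 < T -> cintegrable `[0, T] v -> 0 < eps ->
  exists2 r : R, 0 < r & forall h, cintegrable `[0, T] h ->
    \int[mu]_(s in `[0, T]) normc (v s - h s) <= eps ->
    forall k, r <= normc k -> forall t, t \in `[0, T] ->
      expR (- `|Re k| * t) * normc (fourier_term k h t) <= 3 * eps.
Proof.
move=> T0 iv eps0; have mT := @meas_itv R 0 T.
have [v1 v2] := iv.
have e20 : 0 < eps / 2 by rewrite divr_gt0.
have [g1 cg1 g1P] := continuous_L1_approx e20 v1.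
have [g2 cg2 g2P] := continuous_L1_approx e20 v2.
pose p t := g1 t +i* g2 t.
have [r r0 rP] := @riemann_lebesgue_continuous p T T0 cg1 cg2 eps eps0.
have cp : ccontinuous `[0, T] p by split; exact: continuous_subspaceT.
have ip := ccontinuous_cintegrable cp.
have inegB f1 f2 : cintegrable `[0, T] f1 -> cintegrable `[0, T] f2 ->
    cintegrable `[0, T] (fun s => f1 s - f2 s).
  move=> i1 i2; rewrite (_ : (fun s => _) = (fun s => f1 s + (-1) * f2 s)).
    by apply: cintegrableD => //; exact: cintegrableZ.
  by apply/funext => s; rewrite mulN1r.
have ivp := inegB _ _ iv ip.
have vp : \int[mu]_(s in `[0, T]) normc (v s - p s) <= eps.
  have [w1 w2] := ivp.
  rewrite (splitr eps); apply: le_trans (lerD g1P g2P).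
  have n1 : mu.-integrable `[0, T] (EFin \o (fun t => `|Re (v t) - g1 t|)).
    rewrite (_ : (fun t => _) = (fun t => `|Re (v t - p t)|)).
      exact: integrable_norm w1.
    by apply/funext => t; rewrite ReD ReN.
  have n2 : mu.-integrable `[0, T] (EFin \o (fun t => `|Im (v t) - g2 t|)).
    rewrite (_ : (fun t => _) = (fun t => `|Im (v t - p t)|)).
      exact: integrable_norm w2.
    by apply/funext => t; rewrite ImD ImN.
  rewrite -RintegralD//; apply: le_Rintegral => //.
  - exact: cintegrable_normc.
  - exact: (integrableD mT n1 n2).
  - by move=> t _; rewrite (le_trans (ler_normc_ReIm _))// ReD ReN ImD ImN.
exists r => // h ih vh k rk t tT.
have ihp := inegB _ _ ih ip.
have hp : \int[mu]_(s in `[0, T]) normc (h s - p s) <= 2 * eps.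
  have ivh := inegB _ _ iv ih.
  rewrite mulr_natl mulr2n; apply: le_trans (lerD vh vp).
  rewrite -RintegralD//; try exact: cintegrable_normc.
  apply: le_Rintegral => //; first exact: cintegrable_normc.
    exact: (integrableD mT (cintegrable_normc mT ivh) (cintegrable_normc mT ivp)).
  move=> s _; rewrite -[normc (v s - h s)]normcN opprB.
  by rewrite -[h s - p s](subrKA (v s)) le_normcD.
have := normc_fourier_term_le k tT ihp; have := rP k rk t tT.
have -> : fourier_term k h t =
    fourier_term k (fun s => h s - p s) t + fourier_term k p t.
  rewrite -fourier_termD; [|exact: cintegrable_itvS tT _..].
  by congr fourier_term; apply/funext => s; rewrite subrK.
set A := fourier_term k (fun s => h s - p s) t; set B := fourier_term k p t.
have := ler_wpM2l (expR_ge0 (- `|Re k| * t)) (le_normcD A B).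
rewrite mulrDr; lra.
Qed.

End RiemannLebesgue.

(** * Bessel's inequality *)

Section Bessel.
Context {R : realType}.
Local Notation C := R[i].
Local Notation Re := complex.Re.
Local Notation Im := complex.Im.
Local Notation mu := (@lebesgue_measure R).
Variable T : R.
Hypothesis T0 : 0 < T.
Implicit Types (j l : int) (t : R).

Let fourier j t : C := cexp ('i%C * lambda0 T j * t%:C).

Lemma fourierE j t : fourier j t =
  cos (2 * pi / T * j%:~R * t) +i* sin (2 * pi / T * j%:~R * t).
Proof.
rewrite /fourier /cexp /lambda0 !ReMr !ImMr [Re _]/= [Im _]/=.
by rewrite !mul0r expR0 !mul1r.
Qed.

Lemma fourierD j l t : fourier j t * fourier l t = fourier (j + l) t.
Proof.
rewrite /fourier -cexpD; congr cexp; rewrite -mulrDl -mulrDr /lambda0.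
by rewrite -rmorphD -mulrDr -intrD.
Qed.

Lemma conj_fourier j t : conjc (fourier j t) = fourier (- j) t.
Proof. by rewrite !fourierE /= intrN !mulrN mulNr cosN sinN. Qed.

Lemma fourier_T j : fourier j T = 1.
Proof.
have h (n : nat) : fourier n T = 1.
  rewrite fourierE (_ : _ * T = 0 + pi *+ 2 *+ n); last first.
    rewrite add0r -[pi *+ 2 *+ n]mulr_natl -[pi *+ 2]mulr_natl -pmulrn.
    by field; rewrite gt_eqF.
  by rewrite (periodicn (@cosD2pi R)) (periodicn (@sinD2pi R)) cos0 sin0.
case: j => n; first exact: h.
by rewrite NegzE -conj_fourier h conjc1.
Qed.

Lemma cintegral_fourier j :
  cintegral `[0, T] (fourier j) = if j == 0 then T%:C else 0.
Proof.
have T0' := ltW T0; have mT := @meas_itv R 0 T.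
have if_ : cintegrable `[0, T] (fourier j).
  by apply: ccontinuous_cintegrable; exact: ccontinuous_cexp.
case: eqP => [->|/eqP j0].
  rewrite (eq_cintegral (g := fun=> 1)); last first.
    by move=> s _; rewrite fourierE mulr0 mul0r cos0 sin0.
  apply: complex_ext; rewrite ?Re_cintegral ?Im_cintegral Rintegral_itv_cst//=.
    by rewrite mul1r subr0.
  by rewrite mul0r.
have := cintegral_cexp ('i%C * lambda0 T j) T0'.
rewrite -/(fourier j T) fourier_T mulr0 cexp0 subrr cintegralZ//.
move=> /eqP; rewrite mulf_eq0 => /orP[|/eqP//].
rewrite mulf_eq0 => /orP[/eqP[]/eqP|/eqP[]/eqP]; first by rewrite oner_eq0.
rewrite !mulf_eq0 intr_eq0 (negbTE j0) orbF invr_eq0 (gt_eqF T0) orbF.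
by rewrite pnatr_eq0 (gt_eqF (pi_gt0 R)).
Qed.

Lemma bessel (v : R -> C) t (ks : seq int) : uniq ks -> t \in `[0, T] ->
  cintegrable `[0, T] v ->
  mu.-integrable `[0, T] (EFin \o (fun s => normc (v s) ^+ 2)) ->
  \sum_(j <- ks) normc (cintegral `[0, t] (fun s => fourier j s * v s)) ^+ 2 <=
  T * \int[mu]_(s in `[0, T]) normc (v s) ^+ 2.
Proof.
move=> uks tT iv ivv; have mT := @meas_itv R 0 T; have mt := @meas_itv R 0 t.
pose c j := cintegral `[0, t] (fun s => fourier j s * v s).
set S := \sum_(j <- ks) _.
(* Duality: [v] is tested against the trigonometric polynomial [P], which
   gives [S], while the squared L^2-norm of [P] is [T * S]. *)
pose P s := \sum_(j <- ks) conjc (c j) * fourier j s.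
have cf j D : ccontinuous D (fourier j) by exact: ccontinuous_cexp.
have cP D : ccontinuous D P.
  rewrite /P; elim: (ks) => [|j r IH].
    under [X in ccontinuous _ X]eq_fun do rewrite big_nil.
    exact: ccontinuous_cst.
  under [X in ccontinuous _ X]eq_fun do rewrite big_cons.
  apply: ccontinuousD => //; apply: ccontinuousM => //; exact: ccontinuous_cst.
have ivt := cintegrable_itvS tT iv.
have SE : S%:C = cintegral `[0, t] (fun s => P s * v s).
  rewrite (eq_cintegral (g := fun s =>
      \sum_(j <- ks) conjc (c j) * (fourier j s * v s))); last first.
    by move=> s _; rewrite /P mulr_suml; apply: eq_bigr => j _; rewrite mulrA.
  rewrite cintegral_sum//; last first.
    by move=> j; apply: cintegrableZ => //; exact: cintegrable_mul_continuous.
  rewrite /S rmorph_sum; apply: eq_bigr => j _.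
  rewrite cintegralZ//; last exact: cintegrable_mul_continuous.
  by rewrite -/(c j) sqr_normcE; apply: complex_ext; case: (c j) => a b /=; ring.
have PE : \int[mu]_(s in `[0, T]) normc (P s) ^+ 2 = T * S.
  transitivity (Re (cintegral `[0, T] (fun s => P s * conjc (P s)))).
    rewrite Re_cintegral; apply: eq_Rintegral => s _.
    by rewrite sqr_normcE; case: (P s) => a b /=; ring.
  rewrite (eq_cintegral (g := fun s => \sum_(j <- ks) \sum_(l <- ks)
      conjc (c j) * c l * fourier (j - l) s)); last first.
    move=> s _; rewrite /P rmorph_sum mulr_suml; apply: eq_bigr => j _.
    rewrite mulr_sumr; apply: eq_bigr => l _.
    rewrite rmorphM -[X in _ * (X * _)]/(conjc (conjc (c l))) conjcK.
    by rewrite -[X in _ * (_ * X)]/(conjc (fourier l s)) conj_fourier -fourierD; ring.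
  have iF j l : cintegrable `[0, T] (fun s => conjc (c j) * c l * fourier (j - l) s).
    by apply: cintegrableZ => //; apply: ccontinuous_cintegrable.
  rewrite cintegral_sum//; last by move=> j; exact: cintegrable_sum.
  rewrite [X in Re X](_ : _ = (T * S)%:C)//.
  rewrite /S mulr_sumr rmorph_sum big_seq [RHS]big_seq; apply: eq_bigr => j jks.
  rewrite cintegral_sum// (bigD1_seq j)// [X in _ + X = _]big1 ?addr0.
    rewrite cintegralZ ?cintegral_fourier ?subrr ?eqxx//; last exact: ccontinuous_cintegrable.
    by rewrite sqr_normcE -/(c j); apply: complex_ext; case: (c j) => a b /=; ring.
  move=> l lj; rewrite cintegralZ ?cintegral_fourier//; last exact: ccontinuous_cintegrable.
  by rewrite subr_eq0 eq_sym (negbTE lj) mulr0.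
have iPP : mu.-integrable `[0, T] (EFin \o (fun s => normc (P s) ^+ 2)).
  apply: continuous_compact_integrable; first exact: segment_compact.
  by move=> s; apply: cvgM; exact: ccontinuous_normc.
have iG : mu.-integrable `[0, T]
    (EFin \o (fun s => T / 2 * normc (v s) ^+ 2 + (2 * T)^-1 * normc (P s) ^+ 2)).
  exact: (integrableD mT (integrableZl mT (T / 2) ivv) (integrableZl mT (2 * T)^-1 iPP)).
have iPv : cintegrable `[0, t] (fun s => P s * v s) by exact: cintegrable_mul_continuous.
(* Young's inequality with weights T / 2 and 1 / (2 T): as the squared norm of [P] is [T * S], the
   second term integrates to [S / 2] and is absorbed on the left. *)
have : S <= \int[mu]_(s in `[0, T])
    (T / 2 * normc (v s) ^+ 2 + (2 * T)^-1 * normc (P s) ^+ 2).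
  have -> : S = Re (cintegral `[0, t] (fun s => P s * v s)) by rewrite -SE.
  apply: (le_trans (ler_norm _)); apply: (le_trans (ler_Re_normc _)).
  apply: (le_trans (normc_cintegral_le mt iPv)).
  (* The majorant is nonnegative, so [0, t] may be enlarged to [0, T], where the exponentials are
     orthogonal. *)
  apply: le_trans (le_Rintegral_itv tT iG _); last first.
    move=> s _; rewrite addr_ge0// mulr_ge0 ?sqr_ge0// ?invr_ge0 ?divr_ge0 ?mulr_ge0// ltW//.
  apply: le_Rintegral => //; [exact: cintegrable_normc|exact: integrable_itvS tT iG|].
  move=> s _; rewrite normcM -subr_ge0.
  rewrite [leRHS](_ : _ = (2 * T)^-1 * (T * normc (v s) - normc (P s)) ^+ 2).
    by rewrite mulr_ge0 ?sqr_ge0// invr_ge0 mulr_ge0// ltW.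
  by field; rewrite gt_eqF.
rewrite RintegralD//; last 2 first.
- exact: (integrableZl mT (T / 2) ivv).
- exact: (integrableZl mT (2 * T)^-1 iPP).
rewrite !RintegralZl// PE (_ : _^-1 * (T * S) = S / 2); last by field; rewrite gt_eqF.
set V := Rintegral _ _ _; lra.
Qed.

End Bessel.

(** * Square-integrable potentials *)

Section Potential.
Context {R : realType} {T : R}.
Local Notation C := R[i].
Local Notation Re := complex.Re.
Local Notation Im := complex.Im.
Local Notation mu := (@lebesgue_measure R).
Implicit Types (q p : L2 T).

Lemma L2_sqr_integrable q :
  mu.-integrable `[0, T] (EFin \o (fun t => normc (q t) ^+ 2)).
Proof.
apply/integrableP; split.
  apply/measurable_EFinP; apply: measurable_funX; apply: measurable_normc.
    exact: L2_measurable_Re.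
  exact: L2_measurable_Im.
under eq_integral do rewrite /= ger0_norm ?sqr_ge0//.
exact: L2_finite.
Qed.

Lemma L2_cintegrable q : cintegrable `[0, T] q.
Proof.
have mT := @meas_itv R 0 T.
have i1 : mu.-integrable `[0, T] (EFin \o (fun=> 1 : R)).
  by apply: continuous_itv_integrable => x; exact: cvg_cst.
apply: (@le_cintegrable _ _ _ (fun t => 1 + normc (q t) ^+ 2)) => //.
- exact: L2_measurable_Re.
- exact: L2_measurable_Im.
- by move=> t _; have := sqr_ge0 (normc (q t) - 1); have := normc_ge0 (q t); nra.
- exact: (integrableD mT i1 (L2_sqr_integrable q)).
Qed.

Definition sqrL2 q : R := \int[mu]_(t in `[0, T]) normc (q t) ^+ 2.

Lemma sqrL2_ge0 q : 0 <= sqrL2 q.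
Proof. by apply: Rintegral_ge0 => t _; exact: sqr_ge0. Qed.

Lemma L2B_cintegrable p q : cintegrable `[0, T] (fun t => p t - q t).
Proof.
rewrite (_ : (fun t => _) = (fun t => p t + (-1) * q t)).
  apply: cintegrableD; [exact: meas_itv|exact: L2_cintegrable|].
  by apply: cintegrableZ; [exact: meas_itv|exact: L2_cintegrable].
by apply/funext => t; rewrite mulN1r.
Qed.

Lemma L2B_sqr_integrable p q :
  mu.-integrable `[0, T] (EFin \o (fun t => normc (p t - q t) ^+ 2)).
Proof.
have mT := @meas_itv R 0 T.
have [d1 d2] := L2B_cintegrable p q.
apply: (le_integrable mT _ _ (integrableD mT
  (integrableZl mT 2 (L2_sqr_integrable p)) (integrableZl mT 2 (L2_sqr_integrable q)))).
  apply/measurable_EFinP; apply: measurable_funX; apply: measurable_normc;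
    apply/measurable_EFinP.
    exact: measurable_int d1.
  exact: measurable_int d2.
move=> t _ /=; rewrite lee_fin ger0_norm ?sqr_ge0// ger0_norm; last first.
  by rewrite addr_ge0// mulr_ge0// sqr_ge0.
have := le_normcD (p t) (- q t); rewrite normcN.
have := normc_ge0 (p t - q t); have := sqr_ge0 (normc (p t) - normc (q t)).
move: (normc (p t - q t)) (normc (p t)) (normc (q t)) => x y z; nra.
Qed.

Lemma L2ball_sqr p q (e : R) : 0 < e -> L2ball p e q ->
  \int[mu]_(t in `[0, T]) normc (p t - q t) ^+ 2 <= e ^+ 2.
Proof.
move=> e0; rewrite /L2ball /L2norm => pq; rewrite ltW//.
rewrite -[ltLHS]sqr_sqrtr; last by apply: Rintegral_ge0 => t _; exact: sqr_ge0.
by rewrite ltrXn2r// ?sqrtr_ge0.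
Qed.

(** Cauchy-Schwarz against the constant 1 costs a factor sqrt T; since T <= (T + 1)^2, dividing the
    radius by [T + 1] compensates for it without a root. *)
Lemma L2ball_L1 p q (e : R) : 0 < T -> 0 < e -> L2ball p (e / (T + 1)) q ->
  \int[mu]_(t in `[0, T]) normc (p t - q t) <= e.
Proof.
move=> T0 e0 pq; have mT := @meas_itv R 0 T.
have T1 : 0 < T + 1 by rewrite addr_gt0.
have d0 : 0 < e / (T + 1) by rewrite divr_gt0.
have i1 : mu.-integrable `[0, T] (EFin \o (fun=> 1 ^+ 2 : R)).
  by apply: continuous_itv_integrable => x; exact: cvg_cst.
have i1d : mu.-integrable `[0, T] (EFin \o (fun t => 1 * normc (p t - q t))).
  under [X in _ \o X]eq_fun do rewrite mul1r.
  by apply: cintegrable_normc => //; exact: L2B_cintegrable.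
have := @Rintegral_cauchy_schwarz _ _ _ mu _ (fun=> 1) _ mT i1 (L2B_sqr_integrable p q) i1d.
rewrite (_ : \int[mu]_(t in `[0, T]) 1 ^+ 2 = T); last first.
  by under eq_Rintegral do rewrite expr1n; rewrite Rintegral_itv_cst ?ltW// mul1r subr0.
under eq_Rintegral do rewrite mul1r.
have := L2ball_sqr d0 pq.
set A := \int[mu]_(t in _) _ ^+ 2; set I := \int[mu]_(t in _) _ => Ale Ile.
have I0 : 0 <= I by apply: Rintegral_ge0 => t _; exact: normc_ge0.
rewrite -(@ler_pXn2r _ 2) ?nnegrE ?(ltW e0)//.
apply: (le_trans Ile); apply: (@le_trans _ _ (T * (e / (T + 1)) ^+ 2)).
  by rewrite ler_wpM2l// ltW.
rewrite [leLHS](_ : _ = e ^+ 2 * (T / (T + 1) ^+ 2)); last by field; rewrite gt_eqF.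
rewrite -[leRHS]mulr1 ler_wpM2l ?sqr_ge0// ler_pdivrMr ?exprn_gt0// mul1r; nra.
Qed.

Lemma sqrL2_ball p q (e : R) : 0 < e -> L2ball p e q ->
  sqrL2 q <= 2 * sqrL2 p + 2 * e ^+ 2.
Proof.
move=> e0 pq; have mT := @meas_itv R 0 T.
apply: (@le_trans _ _ (2 * sqrL2 p +
    2 * \int[mu]_(t in `[0, T]) normc (p t - q t) ^+ 2)); last first.
  by rewrite lerD2l ler_wpM2l// L2ball_sqr.
have ip := L2_sqr_integrable p; have ipq := L2B_sqr_integrable p q.
have ip2 := integrableZl mT 2 ip; have ipq2 := integrableZl mT 2 ipq.
rewrite /sqrL2 -!RintegralZl// -RintegralD//; apply: le_Rintegral => //.
- exact: L2_sqr_integrable.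
- exact: (integrableD mT ip2 ipq2).
move=> t _.
have := le_normcD (p t) (q t - p t); rewrite addrC subrK -[normc (q t - p t)]normcN opprB.
have := normc_ge0 (q t); have := sqr_ge0 (normc (p t) - normc (p t - q t)).
move: (normc (p t - q t)) (normc (p t)) (normc (q t)) => x y z; nra.
Qed.

(** Compactness as an exchange of quantifiers. The local property holds for all [r] beyond a
    threshold, that is near +oo, so finitely many local thresholds have a common one. It is assumed
    around every [q0] because limit points of [Q] may lie outside [Q]. *)
Lemma precompact_bound (P : R -> L2 T -> Prop) (Q : set (L2 T)) :
  (forall q0, exists2 d, 0 < d & exists r0, forall q, L2ball q0 d q ->
    forall r, r0 <= r -> P r q) ->
  precompact Q -> exists2 r : R, 0 < r & forall q, Q q -> P r q.
Proof.
move=> Ploc; rewrite precompactE => /compact_near_coveringP nc.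
have H : \forall r \near +oo, closure Q `<=` P r.
  apply: nc => q0 _; have [d d0 [r0 r0P]] := Ploc q0.
  exists (ball q0 d, [set r | r0 <= r]) => /=.
    by split; [exact: nbhsx_ballx|apply: nbhs_pinfty_ge; exact: num_real].
  by move=> [q r]/= [qd rr]; exact: r0P qd _ rr.
near (pinfty_nbhs R) => r; exists r; first by near: r; apply: nbhs_pinfty_gt; exact: num_real.
move=> q Qq; have : closure Q `<=` P r by near: r.
by apply; exact: subset_closure.
Unshelve. all: by end_near. Qed.

End Potential.

(** * The monodromy *)

Section Monodromy.
Context {R : realType} {T : R}.
Local Notation C := R[i].
Local Notation Re := complex.Re.
Local Notation Im := complex.Im.
Local Notation mu := (@lebesgue_measure R).
Hypothesis T0 : 0 < T.
Implicit Types (q p : L2 T) (lam k : C).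

Lemma mulmx2E (A B : 'M[C]_2) i j : (A *m B) i j = A i 0 * B 0 j + A i 1 * B 1 j.
Proof.
by rewrite mxE big_ord_recl big_ord1; congr (_ + A _ _ * B _ _); exact/val_inj.
Qed.

Lemma rowsum_norm2E (A : 'M[C]_2) : rowsum_norm A =
  Num.max (normc (A 0 0) + normc (A 0 1)) (normc (A 1 0) + normc (A 1 1)).
Proof.
rewrite /rowsum_norm !big_ord_recl !big_ord0 !addr0.
rewrite (_ : lift ord0 ord0 = 1); last exact/val_inj.
rewrite [Num.max _ 0]max_l// addr_ge0 ?normc_ge0//.
Qed.

Definition halfq q (t : R) : C := 2^-1 * q t.
Definition halfqJ q (t : R) : C := 2^-1 * - conjc (q t).

Lemma normc_half (z : C) : normc (2^-1 * z) = normc z / 2.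
Proof.
rewrite normcM ComplexField.Normc.normcV mulrC; congr (_ / _).
by rewrite normcE/= [X in Num.sqrt X](_ : _ = 2 ^+ 2) ?sqrtr_sqr ?ger0_norm//; ring.
Qed.

Lemma halfq_cintegrable q : cintegrable `[0, T] (halfq q).
Proof. by apply: cintegrableZ; [exact: meas_itv|exact: L2_cintegrable]. Qed.

Lemma halfqJ_cintegrable q : cintegrable `[0, T] (halfqJ q).
Proof.
apply: cintegrableZ; first exact: meas_itv.
have [q1 q2] := L2_cintegrable q; split.
  rewrite (_ : _ \o _ = EFin \o (fun t => -1 * Re (q t))).
    exact: (integrableZl (meas_itv 0 T) (-1) q1).
  by apply/funext => t /=; case: (q t) => a b /=; rewrite mulN1r.
rewrite (_ : _ \o _ = EFin \o (fun t => Im (q t)))//.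
by apply/funext => t /=; case: (q t) => a b /=; rewrite opprK.
Qed.

Lemma normc_halfq q t : normc (halfq q t) = normc (q t) / 2.
Proof. exact: normc_half. Qed.

Lemma normc_halfqJ q t : normc (halfqJ q t) = normc (q t) / 2.
Proof. by rewrite /halfqJ normc_half normcN normcJ. Qed.

Definition kappa lam : C := 2^-1 * ('i%C * lam).

Lemma vacuum_monodromyE lam : [/\ vacuum_monodromy T lam 0 0 = cexp (kappa lam * T%:C),
  vacuum_monodromy T lam 0 1 = 0, vacuum_monodromy T lam 1 0 = 0 &
  vacuum_monodromy T lam 1 1 = cexp (- kappa lam * T%:C)].
Proof.
have kT : 'i%C * lam * (T / 2)%:C = kappa lam * T%:C.
  have -> : (T / 2)%:C = T%:C * 2^-1 :> C by rewrite rmorphM fmorphV rmorph_nat.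
  by rewrite /kappa; ring.
by rewrite /vacuum_monodromy /mx2 !mxE/= -complexiE kT mulNr.
Qed.

Section Estimate.
Variables (q : L2 T) (lam : C) (F : R -> 'M[C]_2).
Hypothesis FP : fundamental_solution T q lam F.

Let k := kappa lam.

Let FE t i j : t \in `[0, T] -> F t i j = (1%:M : 'M[C]_2) i j +
  cintegral `[0, t] (fun s => F s i 0 * alpha q lam s 0 j + F s i 1 * alpha q lam s 1 j).
Proof.
move=> tT; have [_ /(_ t tT i j) ->] := FP; congr (_ + _).
by apply: eq_cintegral => s _; rewrite mulmx2E.
Qed.

Let cF i j : ccontinuous `[0, T] (fun t => F t i j).
Proof. by have [/(_ i j)] := FP. Qed.

Let alphaE s : [/\ alpha q lam s 0 0 = k, alpha q lam s 0 1 = halfq q s,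
  alpha q lam s 1 0 = halfqJ q s & alpha q lam s 1 1 = - k].
Proof.
rewrite /alpha /mx2 !mxE/= /k /kappa /halfq /halfqJ complexiE.
by split => //; rewrite mulrN.
Qed.

Definition weighted_fourier_term k v t := expR (- `|Re k| * t) * normc (fourier_term k v t).

(** Up to a numerical factor, the constant of [system_estimate] as a function of the squared
    L^2-norm of the potential; it does not involve lam. *)
Definition growth_const (N : R) := (N + 2 * T * N ^+ 2) * expR (2 * T * N ^+ 2 * T).

(** The square of a row sum is at most twice the sum of the squares, which turns the factors 2 of
    [system_estimate] into 4. The maximum over the rows is bounded by their sum, so that each row
    can later be summed over the frequencies on its own. *)
Lemma monodromy_deviation_le :
  (expR (- `|Re k| * T) * rowsum_norm (F T - vacuum_monodromy T lam)) ^+ 2 <=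
  4 * (weighted_fourier_term k (halfq q) T ^+ 2 +
       weighted_fourier_term (- k) (halfqJ q) T ^+ 2) +
  4 * growth_const (sqrL2 q) *
    (\int[mu]_(t in `[0, T]) weighted_fourier_term k (halfq q) t ^+ 2 +
     \int[mu]_(t in `[0, T]) weighted_fourier_term (- k) (halfqJ q) t ^+ 2).
Proof.
have T0' := ltW T0.
have im := cintegrable_normc (meas_itv 0 T) (L2_cintegrable q).
have imm := L2_sqr_integrable q.
have h1 t : t \in `[0, T] -> normc (halfq q t) <= normc (q t).
  by move=> _; rewrite normc_halfq; have := normc_ge0 (q t); lra.
have h2 t : t \in `[0, T] -> normc (halfqJ q t) <= normc (q t).
  by move=> _; rewrite normc_halfqJ; have := normc_ge0 (q t); lra.
have x00 t : t \in `[0, T] -> F t 0 0 =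
    1 + cintegral `[0, t] (fun s => k * F s 0 0 + F s 0 1 * halfqJ q s).
  move=> tT; rewrite FE// mxE/=; congr (_ + _); apply: eq_cintegral => s _.
  by have [-> _ -> _] := alphaE s; rewrite [k * _]mulrC.
have x01 t : t \in `[0, T] -> F t 0 1 =
    cintegral `[0, t] (fun s => - k * F s 0 1 + F s 0 0 * halfq q s).
  move=> tT; rewrite FE// mxE/= add0r; apply: eq_cintegral => s _.
  by have [_ -> _ ->] := alphaE s; rewrite addrC [- k * _]mulrC.
(* Read backwards, the second row of [F] solves the system of the first one
   for [- k], with the two halves of the potential exchanged. *)
have x11 t : t \in `[0, T] -> F t 1 1 =
    1 + cintegral `[0, t] (fun s => - k * F s 1 1 + F s 1 0 * halfq q s).
  move=> tT; rewrite FE// mxE/=; congr (_ + _); apply: eq_cintegral => s _.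
  by have [_ -> _ ->] := alphaE s; rewrite addrC [- k * _]mulrC.
have x10 t : t \in `[0, T] -> F t 1 0 =
    cintegral `[0, t] (fun s => - - k * F s 1 0 + F s 1 1 * halfqJ q s).
  move=> tT; rewrite FE// mxE/= add0r; apply: eq_cintegral => s _.
  by have [-> _ -> _] := alphaE s; rewrite opprK [k * _]mulrC.
have := system_estimate T0' (halfqJ_cintegrable q) (halfq_cintegrable q) im imm h2 h1
  (cF 0 0) (cF 0 1) x00 x01.
have := system_estimate T0' (halfq_cintegrable q) (halfqJ_cintegrable q) im imm h1 h2
  (cF 1 1) (cF 1 0) x11 x10.
rewrite ReN normrN.
set e := expR _.
have [V00 V01 V10 V11] := vacuum_monodromyE lam.
rewrite rowsum_norm2E.
have subE i j : (F T - vacuum_monodromy T lam) i j = F T i j - vacuum_monodromy T lam i j.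
  by rewrite !mxE.
rewrite !subE V00 V01 V10 V11 !subr0 /growth_const /weighted_fourier_term.
rewrite ReN normrN -/e -/(sqrL2 q).
set a := normc (F T 0 0 - _); set b := normc (F T 0 1).
set c := normc (F T 1 0); set d := normc (F T 1 1 - _).
set f1 := e * normc (fourier_term k _ T); set f2 := e * normc (fourier_term (- k) _ T).
set I1 := \int[mu]_(t in _) _; set I2 := \int[mu]_(t in _) _.
set K := sqrL2 q + _; set E := expR (2 * _ * _ * _) => r2 r1.
have e0 : 0 <= e by exact: expR_ge0.
have I10 : 0 <= I1 by apply: Rintegral_ge0 => t _; exact: sqr_ge0.
have I20 : 0 <= I2 by apply: Rintegral_ge0 => t _; exact: sqr_ge0.
have K0 : 0 <= K by rewrite /K addr_ge0 ?sqrL2_ge0// !mulr_ge0// ?sqrL2_ge0.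
have KE : 0 <= K * E by rewrite mulr_ge0 ?expR_ge0.
have h (x y f I : R) : 0 <= I ->
    (e * x) ^+ 2 + (e * y) ^+ 2 <= 2 * f ^+ 2 + 2 * K * E * I ->
    (e * (x + y)) ^+ 2 <= 4 * f ^+ 2 + 4 * (K * E) * I.
  move=> I0 xy; have := sqr_ge0 (e * x - e * y); rewrite mulrDr.
  move: xy; rewrite -[2 * K * E]mulrA; move: (K * E) (e * x) (e * y) => Y z w; nra.
have [le1|le1] := leP (a + b) (c + d).
  have := h d c f2 I1 I10 r2; rewrite [d + c]addrC.
  have := sqr_ge0 f1; have := mulr_ge0 KE I20; lra.
have := h a b f1 I2 I20 r1.
have := sqr_ge0 f2; have := mulr_ge0 KE I10; lra.
Qed.

End Estimate.

Lemma growth_const_ge0 (N : R) : 0 <= N -> 0 <= growth_const N.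
Proof.
have T0' := ltW T0.
by move=> N0; rewrite mulr_ge0 ?expR_ge0// addr_ge0// !mulr_ge0// sqr_ge0.
Qed.

Lemma le_growth_const (N B : R) : 0 <= N -> N <= B -> growth_const N <= growth_const B.
Proof.
have T0' := ltW T0.
move=> N0 NB; have B0 := le_trans N0 NB.
have NB2 : 2 * T * N ^+ 2 <= 2 * T * B ^+ 2.
  by rewrite ler_wpM2l ?mulr_ge0// lerXn2r.
apply: ler_pM; [|exact: expR_ge0|exact: lerD|by rewrite ler_expR ler_wpM2r].
by rewrite addr_ge0// !mulr_ge0// sqr_ge0.
Qed.

Lemma rowsum_norm_vacuum lam :
  rowsum_norm (vacuum_monodromy T lam) = expR (`|Re (kappa lam)| * T).
Proof.
have [V00 V01 V10 V11] := vacuum_monodromyE lam.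
rewrite rowsum_norm2E V00 V01 V10 V11 ComplexField.Normc.normc0 addr0 add0r.
rewrite !normc_cexp !ReMr ReN.
have [k0|k0] := leP 0 (Re (kappa lam)).
  rewrite max_l ?ger0_norm// ler_expR; have := mulr_ge0 k0 (ltW T0); lra.
rewrite max_r ?ltr0_norm// ler_expR; have := mulr_le0_ge0 (ltW k0) (ltW T0); lra.
Qed.

Lemma weighted_fourier_term_sqr_integrable k v : cintegrable `[0, T] v ->
  mu.-integrable `[0, T] (EFin \o (fun t => weighted_fourier_term k v t ^+ 2)).
Proof.
move=> iv; apply: continuous_compact_integrable; first exact: segment_compact.
have cw : {within `[0, T], continuous (weighted_fourier_term k v)}.
  move=> s; apply: cvgM.
    by apply: continuous_subspaceT; exact: is_derive_continuous (is_derive_expRM _).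
  by apply: ccontinuous_normc; apply: ccontinuous_fourier_term => //; exact: ltW.
by move=> s; apply: cvgM; exact: cw.
Qed.

Lemma weighted_fourier_term_ge0 k v t : 0 <= weighted_fourier_term k v t.
Proof. by rewrite mulr_ge0 ?expR_ge0 ?normc_ge0. Qed.

Lemma Rintegral_weighted_fourier_term_le k v (eta : R) : cintegrable `[0, T] v ->
  (forall t, t \in `[0, T] -> weighted_fourier_term k v t <= eta) ->
  \int[mu]_(t in `[0, T]) weighted_fourier_term k v t ^+ 2 <= eta ^+ 2 * T.
Proof.
move=> iv le_eta; have mT := @meas_itv R 0 T.
apply: (@le_trans _ _ (\int[mu]_(t in `[0, T]) eta ^+ 2)); last first.
  by rewrite Rintegral_itv_cst ?(ltW T0)// subr0.
apply: le_Rintegral => //.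
- exact: weighted_fourier_term_sqr_integrable.
- by apply: continuous_itv_integrable => x; exact: cvg_cst.
move=> t tT; have w0 := weighted_fourier_term_ge0 k v t.
by rewrite lerXn2r ?nnegrE// ?(le_trans w0) ?le_eta.
Qed.

(** On a small ball around [q0] the two ingredients are uniform: the L^2-norm, hence the growth
    constant, is bounded, and L^1-closeness to [q0] gives one Riemann-Lebesgue threshold. *)
Lemma monodromy_asymptotics_nbhs (q0 : L2 T) (eps : R) : 0 < eps ->
  exists2 d, 0 < d & exists r0, forall q, L2ball q0 d q -> forall r, r0 <= r ->
    forall lam F, fundamental_solution T q lam F -> r <= normc lam ->
      rowsum_norm (F T - vacuum_monodromy T lam) <=
      eps * rowsum_norm (vacuum_monodromy T lam).
Proof.
move=> eps0; have mT := @meas_itv R 0 T.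
pose B := 2 * sqrL2 q0 + 2.
have B0 : 0 <= B by rewrite addr_ge0// mulr_ge0// sqrL2_ge0.
(* If all weighted Fourier terms are at most [eta], the deviation estimate becomes
   [Z * eta ^+ 2]. *)
pose Z := 8 + 8 * growth_const B * T.
have Z0 : 0 < Z.
  by rewrite /Z ltr_wpDr// mulr_ge0 ?(ltW T0)// mulr_ge0 ?growth_const_ge0.
have Z1 : 0 < Z + 1 by rewrite addr_gt0.
(* Since Z <= (Z + 1)^2, this yields [Z * eta ^+ 2 <= eps ^+ 2] without a square root. *)
pose eta := eps / (Z + 1).
have eta0 : 0 < eta by rewrite divr_gt0.
have eta30 : 0 < eta / 3 by rewrite divr_gt0.
have [r1 r10 r1P] := riemann_lebesgue T0 (halfq_cintegrable q0) eta30.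
have [r2 r20 r2P] := riemann_lebesgue T0 (halfqJ_cintegrable q0) eta30.
have T1 : 0 < T + 1 by rewrite addr_gt0.
(* Radius 1 serves the bound [B]; the other radius gives L^1-distance at most [eta / 3], the 3 being
   the loss in [riemann_lebesgue]. *)
exists (Num.min 1 (eta / 3 / (T + 1))).
  by rewrite lt_min ltr01 divr_gt0.
(* The factor 2 reflects |kappa lam| = |lam| / 2. *)
exists (2 * Num.max r1 r2) => q q0q r r0r lam F FP rlam.
have q0q1 : L2ball q0 1 q by rewrite /L2ball (lt_le_trans q0q)// ge_min lexx.
have q0q2 : L2ball q0 (eta / 3 / (T + 1)) q.
  by rewrite /L2ball (lt_le_trans q0q)// ge_min lexx orbT.
have qB : sqrL2 q <= B by have := sqrL2_ball ltr01 q0q1; rewrite expr1n mulr1.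
have L1 := L2ball_L1 T0 eta30 q0q2.
have nk : normc (kappa lam) = normc lam / 2.
  by rewrite /kappa normc_half normcM normcE/= expr0n expr1n add0r sqrtr1 mul1r.
have kr : Num.max r1 r2 <= normc (kappa lam).
  by rewrite nk ler_pdivlMr// mulrC (le_trans r0r).
have inB := cintegrable_normc mT (L2B_cintegrable q0 q).
have d1 : \int[mu]_(s in `[0, T]) normc (halfq q0 s - halfq q s) <= eta / 3.
  apply: le_trans L1; apply: le_Rintegral => //.
    under [X in _ \o X]eq_fun do rewrite -mulrBr normc_half.
    exact: (integrableZr mT 2^-1 inB).
  by move=> s _; rewrite -mulrBr normc_half; have := normc_ge0 (q0 s - q s); lra.
have JB s : normc (- conjc (q0 s) - - conjc (q s)) = normc (q0 s - q s).
  by rewrite -opprD normcN -(normcJ (q0 s - q s)) rmorphB.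
have d2 : \int[mu]_(s in `[0, T]) normc (halfqJ q0 s - halfqJ q s) <= eta / 3.
  apply: le_trans L1; apply: le_Rintegral => //.
    under [X in _ \o X]eq_fun do rewrite -mulrBr normc_half JB.
    exact: (integrableZr mT 2^-1 inB).
  by move=> s _; rewrite -mulrBr normc_half JB; have := normc_ge0 (q0 s - q s); lra.
have w1 t : t \in `[0, T] -> weighted_fourier_term (kappa lam) (halfq q) t <= eta.
  move=> tT; rewrite (_ : eta = 3 * (eta / 3)); last by field.
  apply: (r1P _ (halfq_cintegrable q) d1) => //.
  by apply: le_trans kr; rewrite le_max lexx.
have w2 t : t \in `[0, T] -> weighted_fourier_term (- kappa lam) (halfqJ q) t <= eta.
  move=> tT; rewrite (_ : eta = 3 * (eta / 3)); last by field.
  apply: (r2P _ (halfqJ_cintegrable q) d2) => //.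
  by rewrite normcN; apply: le_trans kr; rewrite le_max lexx orbT.
have TT : T \in `[0, T] by rewrite in_itv/= lexx ltW.
have := monodromy_deviation_le FP.
have := Rintegral_weighted_fourier_term_le (halfq_cintegrable q) w1.
have := Rintegral_weighted_fourier_term_le (halfqJ_cintegrable q) w2.
have s1 : weighted_fourier_term (kappa lam) (halfq q) T ^+ 2 <= eta ^+ 2.
  by rewrite lerXn2r ?nnegrE ?weighted_fourier_term_ge0 ?(ltW eta0)// w1.
have s2 : weighted_fourier_term (- kappa lam) (halfqJ q) T ^+ 2 <= eta ^+ 2.
  by rewrite lerXn2r ?nnegrE ?weighted_fourier_term_ge0 ?(ltW eta0)// w2.
have gB := le_growth_const (sqrL2_ge0 q) qB.
have g0 := growth_const_ge0 (sqrL2_ge0 q).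
set I2 := \int[mu]_(t in _) _ => i2; set I1 := \int[mu]_(t in _) _ => i1.
rewrite rowsum_norm_vacuum; set D := rowsum_norm _ => main.
have ee : expR (- `|Re (kappa lam)| * T) * expR (`|Re (kappa lam)| * T) = 1.
  by rewrite -expRD mulNr addNr expR0.
have e0 : 0 < expR (- `|Re (kappa lam)| * T) by exact: expR_gt0.
rewrite -(ler_pM2l e0) mulrCA ee mulr1.
have D0 : 0 <= expR (- `|Re (kappa lam)| * T) * D.
  rewrite mulr_ge0 ?expR_ge0// /D rowsum_norm2E le_max addr_ge0//; exact: normc_ge0.
rewrite -(@ler_pXn2r _ 2) ?nnegrE ?(ltW eps0)//.
apply: (le_trans main).
apply: (@le_trans _ _ (Z * eta ^+ 2)); last first.
  rewrite /eta [leLHS](_ : _ = eps ^+ 2 * (Z / (Z + 1) ^+ 2)); last by field; rewrite gt_eqF.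
  rewrite -[leRHS]mulr1 ler_wpM2l ?sqr_ge0// ler_pdivrMr ?exprn_gt0// mul1r; nra.
have : growth_const (sqrL2 q) * (I1 + I2) <= growth_const B * (2 * (eta ^+ 2 * T)).
  have II : I1 + I2 <= 2 * (eta ^+ 2 * T) by lra.
  have II0 : 0 <= I1 + I2.
    by apply: addr_ge0; apply: Rintegral_ge0 => t _; exact: sqr_ge0.
  exact: (ler_pM g0 II0 gB II).
rewrite /Z -[4 * growth_const _ * _]mulrA.
by move: (growth_const B) (growth_const _ * _) => G X; lra.
Qed.

(** * Lattice frequencies and the l^2 bound *)

Lemma kappa_lambda0 (j : int) : 2 * kappa (lambda0 T j) = 'i%C * lambda0 T j.
Proof. by rewrite /kappa mulVKf// pnatr_eq0. Qed.

Lemma kappa_lambda0N (j : int) : kappa (lambda0 T (- j)) = - kappa (lambda0 T j).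
Proof. by rewrite /kappa /lambda0 intrN !mulrN rmorphN !mulrN. Qed.

Lemma Re_kappa_lambda0 (j : int) : Re (kappa (lambda0 T j)) = 0.
Proof.
have : Re (2 * kappa (lambda0 T j)) = 0 by rewrite kappa_lambda0 /lambda0 ReMr mul0r.
by rewrite ReMn2; lra.
Qed.

(** As [lambda0 T j] is real, [kappa] is purely imaginary, and both the weight and the prefactor
    exp(- k t) have modulus 1. A Fourier coefficient of [v] cut off at [t] remains. *)
Lemma weighted_fourier_term_lambda0 v t (j : int) :
  weighted_fourier_term (kappa (lambda0 T j)) v t =
  normc (cintegral `[0, t] (fun s => cexp ('i%C * lambda0 T j * s%:C) * v s)).
Proof.
rewrite /weighted_fourier_term /fourier_term kappa_lambda0 normcM normc_cexp ReMr ReN.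
by rewrite Re_kappa_lambda0 normr0 oppr0 !mul0r expR0 !mul1r.
Qed.

Lemma sum_weighted_fourier_term_le v t (ks : seq int) : uniq ks -> t \in `[0, T] ->
  cintegrable `[0, T] v ->
  mu.-integrable `[0, T] (EFin \o (fun s => normc (v s) ^+ 2)) ->
  \sum_(j <- ks) weighted_fourier_term (kappa (lambda0 T j)) v t ^+ 2 <=
  T * \int[mu]_(s in `[0, T]) normc (v s) ^+ 2.
Proof.
move=> uks tT iv ivv; under eq_bigr do rewrite weighted_fourier_term_lambda0.
exact: bessel.
Qed.

(** Bessel's bound is the same for every [t], so integrating the finite sum over [0, T] costs only a
    factor [T]. *)
Lemma sum_Rintegral_weighted_fourier_term_le v (ks : seq int) : uniq ks ->
  cintegrable `[0, T] v ->
  mu.-integrable `[0, T] (EFin \o (fun s => normc (v s) ^+ 2)) ->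
  \sum_(j <- ks)
    \int[mu]_(t in `[0, T]) weighted_fourier_term (kappa (lambda0 T j)) v t ^+ 2 <=
  T * \int[mu]_(s in `[0, T]) normc (v s) ^+ 2 * T.
Proof.
move=> uks iv ivv; have mT := @meas_itv R 0 T.
set V := T * _.
pose f (s : seq int) t := \sum_(j <- s) weighted_fourier_term (kappa (lambda0 T j)) v t ^+ 2.
have [If fE] : mu.-integrable `[0, T] (EFin \o f ks) /\
    \int[mu]_(t in `[0, T]) f ks t = \sum_(j <- ks)
      \int[mu]_(t in `[0, T]) weighted_fourier_term (kappa (lambda0 T j)) v t ^+ 2.
  elim: (ks) => [|j s [IH1 IH2]].
    have f0 : f [::] = fun=> 0 by apply/funext => t; rewrite /f big_nil.
    by rewrite big_nil f0; split; [exact: integrable0|rewrite /Rintegral integral0].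
  have fS : f (j :: s) = fun t => weighted_fourier_term (kappa (lambda0 T j)) v t ^+ 2 + f s t.
    by apply/funext => t; rewrite /f big_cons.
  have iw := weighted_fourier_term_sqr_integrable (kappa (lambda0 T j)) iv.
  rewrite fS big_cons -IH2; split; first exact: (integrableD mT iw IH1).
  by rewrite RintegralD.
rewrite -fE; apply: (@le_trans _ _ (\int[mu]_(t in `[0, T]) V)); last first.
  by rewrite Rintegral_itv_cst ?(ltW T0)// subr0.
apply: le_Rintegral => //.
  by apply: continuous_itv_integrable => x; exact: cvg_cst.
by move=> t tT; exact: sum_weighted_fourier_term_le.
Qed.

Lemma ler_sum_combination (I : Type) (r : seq I) (d a b c e : I -> R) (g A B : R) :
  0 <= g -> (forall j, d j <= 4 * (a j + b j) + g * (c j + e j)) ->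
  \sum_(j <- r) a j <= A -> \sum_(j <- r) b j <= A ->
  \sum_(j <- r) c j <= B -> \sum_(j <- r) e j <= B ->
  \sum_(j <- r) d j <= 8 * A + 2 * g * B.
Proof.
move=> g0 dle aA bA cB eB; apply: (le_trans (ler_sum _ (fun j _ => dle j))).
rewrite big_split/= -!mulr_sumr !big_split/=.
have := ler_wpM2l g0 (lerD cB eB); rewrite !mulrDr -[2 * g * B]mulrA; lra.
Qed.

(** Bessel bounds each sum of endpoint terms by [T * N] and each sum of integrals by [T * N * T];
    there are two of each kind, one per row. *)
Definition deviation_bound (N : R) : R := 8 * (T * N) + 2 * (4 * growth_const N) * (T * N * T).

Lemma l2norm_deviation_le q (F : int -> R -> 'M[C]_2) (B : R) :
  (forall j, fundamental_solution T q (lambda0 T j) (F j)) -> sqrL2 q <= B ->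
  (l2norm (fun j => rowsum_norm (F j T - vacuum_monodromy T (lambda0 T j))) <=
   (Num.sqrt (deviation_bound B))%:E)%E.
Proof.
move=> FP qB; have mT := @meas_itv R 0 T; have T0' := ltW T0.
have B0 := le_trans (sqrL2_ge0 q) qB.
have TT : T \in `[0, T] by rewrite in_itv/= lexx ltW.
pose dev j := rowsum_norm (F j T - vacuum_monodromy T (lambda0 T j)).
have i1 : mu.-integrable `[0, T] (EFin \o (fun s => normc (halfq q s) ^+ 2)).
  under [X in _ \o X]eq_fun do rewrite normc_halfq exprMn.
  exact: (integrableZr mT (2^-1 ^+ 2) (L2_sqr_integrable q)).
have i2 : mu.-integrable `[0, T] (EFin \o (fun s => normc (halfqJ q s) ^+ 2)).
  under [X in _ \o X]eq_fun do rewrite normc_halfqJ exprMn.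
  exact: (integrableZr mT (2^-1 ^+ 2) (L2_sqr_integrable q)).
have b1 : T * \int[mu]_(s in `[0, T]) normc (halfq q s) ^+ 2 <= T * B.
  rewrite ler_wpM2l//; apply: le_trans qB; apply: le_Rintegral => //.
    exact: L2_sqr_integrable.
  by move=> s _; rewrite normc_halfq; have := sqr_ge0 (normc (q s)); lra.
have b2 : T * \int[mu]_(s in `[0, T]) normc (halfqJ q s) ^+ 2 <= T * B.
  rewrite ler_wpM2l//; apply: le_trans qB; apply: le_Rintegral => //.
    exact: L2_sqr_integrable.
  by move=> s _; rewrite normc_halfqJ; have := sqr_ge0 (normc (q s)); lra.
have devB (ks : seq int) : uniq ks -> \sum_(j <- ks) dev j ^+ 2 <= deviation_bound B.
  move=> uks.
  (* The second row carries [- kappa], which is [kappa] at the index [- j]; its sums are Bessel sums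
     over the negated list. *)
  have uks' : uniq (map -%R ks) by rewrite map_inj_uniq//; exact: oppr_inj.
  pose W1 j t := weighted_fourier_term (kappa (lambda0 T j)) (halfq q) t ^+ 2.
  pose W2 j t := weighted_fourier_term (kappa (lambda0 T (- j))) (halfqJ q) t ^+ 2.
  have s1 : \sum_(j <- ks) W1 j T <= T * B.
    exact: le_trans (sum_weighted_fourier_term_le uks TT (halfq_cintegrable q) i1) b1.
  have s2 : \sum_(j <- ks) W2 j T <= T * B.
    apply: le_trans b2.
    apply: le_trans (sum_weighted_fourier_term_le uks' TT (halfqJ_cintegrable q) i2).
    by rewrite big_map.
  have s3 : \sum_(j <- ks) \int[mu]_(t in `[0, T]) W1 j t <= T * B * T.
    apply: le_trans (sum_Rintegral_weighted_fourier_term_le uks (halfq_cintegrable q) i1) _.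
    by rewrite ler_wpM2r.
  have s4 : \sum_(j <- ks) \int[mu]_(t in `[0, T]) W2 j t <= T * B * T.
    apply: (@le_trans _ _ (T * \int[mu]_(s in `[0, T]) normc (halfqJ q s) ^+ 2 * T)).
      apply: le_trans (sum_Rintegral_weighted_fourier_term_le uks' (halfqJ_cintegrable q) i2).
      by rewrite big_map.
    by rewrite ler_wpM2r.
  have dj j : dev j ^+ 2 <= 4 * (W1 j T + W2 j T) + 4 * growth_const B *
      (\int[mu]_(t in `[0, T]) W1 j t + \int[mu]_(t in `[0, T]) W2 j t).
    have := monodromy_deviation_le (FP j).
    rewrite Re_kappa_lambda0 normr0 oppr0 mul0r expR0 mul1r -kappa_lambda0N => h.
    apply: (le_trans h); rewrite lerD2l ler_wpM2r//.
      by rewrite addr_ge0//; apply: Rintegral_ge0 => t _; exact: sqr_ge0.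
    by rewrite ler_wpM2l// le_growth_const// sqrL2_ge0.
  have gB0 : 0 <= 4 * growth_const B by rewrite mulr_ge0// growth_const_ge0.
  apply: (le_trans (ler_sum_combination gB0 dj s1 s2 s3 s4)).
  by [].
have : (\esum_(j in [set: int]) (dev j ^+ 2)%:E <= (deviation_bound B)%:E)%E.
  (* The sum over all integers is the supremum of its finite partial sums. *)
  apply: ge_ereal_sup => _ [A [fA _] <-].
  rewrite fsbig_finite//= sumEFin lee_fin.
  apply: devB; exact: finmap.fset_uniq.
have : (0 <= \esum_(j in [set: int]) (dev j ^+ 2)%:E)%E.
  by apply: esum_ge0 => j _; rewrite lee_fin sqr_ge0.
rewrite /l2norm -/dev; case: (esum _ _) => [x| |]//=.
by rewrite !lee_fin => _; exact: ler_wsqrtr.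
Qed.

End Monodromy.

Theorem theorem3p1 (R : realType) (T : R) (T_gt0 : 0 < T)
    (F : L2 T -> R[i] -> R -> 'M[R[i]]_2)
    (FP : forall (q : L2 T) (lam : R[i]), fundamental_solution T q lam (F q lam)) :
  let M (q : L2 T) (lam : R[i]) := F q lam T in
  let M0 := vacuum_monodromy T in
  let deviation (q : L2 T) (k : int) :=
    rowsum_norm (M q (lambda0 T k) - M0 (lambda0 T k)) in
  (forall q : L2 T,
     (forall eps : R, 0 < eps ->
        exists2 r : R, 0 < r &
          forall lam : R[i], r <= normc lam ->
            rowsum_norm (M q lam - M0 lam) <= eps * rowsum_norm (M0 lam)) /\
     (l2norm (deviation q) < +oo)%E) /\
  (forall Q : set (L2 T), precompact Q ->
     (forall eps : R, 0 < eps ->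
        exists2 r : R, 0 < r &
          forall q : L2 T, Q q -> forall lam : R[i], r <= normc lam ->
            rowsum_norm (M q lam - M0 lam) <= eps * rowsum_norm (M0 lam)) /\
     (exists B : R, forall q : L2 T, Q q -> (l2norm (deviation q) <= B%:E)%E)).
Proof.
move=> M M0 deviation; split=> [q|Q cQ]; split.
(* A single potential is the centre of its own ball. *)
- move=> eps eps0; have [d d0 [r0 r0P]] := monodromy_asymptotics_nbhs T_gt0 q eps0.
  exists (Num.max 1 r0) => [|lam rlam]; first by rewrite lt_max ltr01.
  apply: (r0P q (ballxx q d0) (Num.max 1 r0) _ lam (F q lam) (FP q lam)) => //.
  by rewrite le_max lexx orbT.
- apply: le_lt_trans (ltry _).
  exact: (l2norm_deviation_le T_gt0 (fun j => FP q (lambda0 T j)) (lexx _)).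
- move=> eps eps0; pose P r q := forall lam : R[i], r <= normc lam ->
    rowsum_norm (M q lam - M0 lam) <= eps * rowsum_norm (M0 lam).
  apply: (@precompact_bound R T P Q) => // q0.
  have [d d0 [r0 r0P]] := monodromy_asymptotics_nbhs T_gt0 q0 eps0.
  by exists d => //; exists r0 => q qd r rr lam rlam; exact: (r0P q qd r rr lam (F q lam)).
(* The l^2 bound depends on the potential only through a bound on its L^2-norm, and that norm is
   locally bounded, so the compactness lemma applies with the bound itself as threshold. *)
- have [B _ BP] : exists2 B : R, 0 < B & forall q, Q q -> sqrL2 q <= B.
    apply: (@precompact_bound R T (fun B q => sqrL2 q <= B)) => // q0.
    exists 1 => //; exists (2 * sqrL2 q0 + 2) => q qd r; apply: le_trans.
    by have := sqrL2_ball ltr01 qd; rewrite expr1n mulr1.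
  exists (Num.sqrt (@deviation_bound R T B)) => q /BP.
  exact: (l2norm_deviation_le T_gt0 (fun j => FP q (lambda0 T j))).
Qed.
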